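(* Let $\alpha$ be a cyclotomic integer of length $l(\alpha)=3$. Then $$[\mathbb{Q}_{c(\alpha)}:\mathbb{Q}(\alpha)] \leq 4,$$ with equality holding if and only if $\alpha$ is of the form $$\epsilon\left(\zeta_6^{c}+\zeta_5^{a}+\zeta_5^{4a}\right),$$ where $c\in(\mathbb{Z}/6\mathbb{Z})^\times$, $a\in(\mathbb{Z}/5\mathbb{Z})^\times$, and $\epsilon$ is some root of unity whose order is a multiple of $4$ not divisible by either $3$ or $5$.
   Context: For a positive integer $n$, $\mathbb{Q}_n$ denotes the extension of $\mathbb{Q}$ generated by a primitive $n$th root of unity in $\mathbb{C}$, and $\zeta_m=e^{2\pi i/m}$. A cyclotomic integer is an algebraic integer that can be expressed as a sum of complex roots of unity (repetitions allowed). A representation $\alpha=\sum_{i=1}^k \epsilon_i$ with each $\epsilon_i$ a root of unity has weight $k$. The length $l(\alpha)$ of a cyclotomic integer $\alpha$ is the smallest weight among all representations of $\alpha$ as a sum of roots of unity. The conductor $c(\alpha)$ is the smallest positive integer such that $\mathbb{Q}(\alpha)\subseteq\mathbb{Q}_{c(\alpha)}$ (unrelated to the exponent $c$). The order of a root of unity is its multiplicative order. *)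

(* Defs.v *)
From mathcomp Require Import all_boot all_order all_algebra all_field.

Set Implicit Arguments.
Unset Strict Implicit.
Unset Printing Implicit Defensive.

Import GRing.Theory Num.Theory.
Local Open Scope ring_scope.

(* All numbers live in algC, the algebraic closure of the rationals in the    *)
(* complex numbers: sums of roots of unity are algebraic.                     *)

(* m.-root (-1) is the m-th root of -1 of least nonnegative argument (and is  *)
(* -1 when m = 1), that is e^(i pi / m); its square is e^(2 i pi / m).        *)
Definition zeta (m : nat) : algC := m.-root (-1) ^+ 2.

Definition root_of_unity (e : algC) : Prop :=
  exists2 n : nat, (0 < n)%N & n.-unity_root e.

Definition has_weight (alpha : algC) (k : nat) : Prop :=
  exists2 e : 'I_k -> algC,
    forall i, root_of_unity (e i) & alpha = \sum_(i < k) e i.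

Definition cyclotomic_integer (alpha : algC) : Prop :=
  alpha \in Aint /\ exists k, has_weight alpha k.

Definition is_length (alpha : algC) (k : nat) : Prop :=
  has_weight alpha k /\ forall j, has_weight alpha j -> (k <= j)%N.

(* Q(x) and Q(y) are compared inside an abstract number field L containing    *)
(* copies xy`_0 and xy`_1 of x and y, where <<1; z>> is the subfield          *)
(* generated by z over the rationals. Q_sub x y: Q(x) is contained in Q(y).   *)
Definition Q_sub (x y : algC) : bool :=
  let: existT L (existT _ (exist2 xy _ _)) := num_field_exists [:: x; y] in
  (<<1; xy`_0>> <= <<1; xy`_1>>)%VS.

(* The degree [Q(y) : Q(x)], meaningful when Q(x) is contained in Q(y): the   *)
(* natural-number quotient underlying \dim_E F is then exact.                 *)
Definition Q_degree (y x : algC) : nat :=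
  let: existT L (existT _ (exist2 xy _ _)) := num_field_exists [:: x; y] in
  (\dim_(<<1; xy`_0>>) <<1; xy`_1>>)%VS.

(* For n > 0, n.-1.+1 is n.                                                   *)
Definition prim_root (n : nat) : algC :=
  sval (C_prim_root_exists (ltn0Sn n.-1)).

Definition is_conductor (alpha : algC) (n : nat) : Prop :=
  [/\ (0 < n)%N, Q_sub alpha (prim_root n)
    & forall m, (0 < m)%N -> Q_sub alpha (prim_root m) -> (n <= m)%N].

(* Main.v *)
From mathcomp Require Import all_boot all_order all_fingroup all_algebra all_field.
From mathcomp Require Import ring.
Require Import Defs.

(* A shortest representation alpha = e1 + e2 + e3 of alpha in Q_n uses only
   (lcm 2 n)-th roots of unity, and by minimality of the conductor n these
   generate all the n-th roots of unity. So an element u of Gal(Q_n / Q(alpha))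
   is determined by its values on the e_i. If u does not permute the e_i, then
   e1 + e2 + e3 - u e1 - u e2 - u e3 is a vanishing sum of six roots of unity
   without proper vanishing subsum, hence a rotation of
   - w - w^2 + z + z^2 + z^3 + z^4, with w, z primitive third and fifth roots of
   unity; this leaves one representation besides (e_i), and at most four u. If
   every u permutes the e_i, the Galois group embeds in S_3 and is abelian, so
   it has order at most 3. In degree 4 some s fixes the e_i of the form - rho w
   and swaps the other two, while some t maps rho to - rho and w to w^2, which
   forces the shape of alpha and of the order of rho. *)

Set Implicit Arguments.
Unset Strict Implicit.
Unset Printing Implicit Defensive.

Import Order.TTheory GRing.Theory Num.Theory.
Local Open Scope ring_scope.

(** One averaging device serves both for shortest and for vanishing sums. If x_i^M = 1 and a prime p
    divides M, the automorphisms fixing the (M/p)-th roots of unity separate the x_i by the value of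
    x_i^(M/p). For a shortest sum in Q_n this excludes every order beyond lcm 2 n; the 2 has to
    stay, since -1 is rational and the e_i may have order 2n with n odd. For a vanishing sum without
    proper vanishing subsum, rotated to contain 1, it makes the common order squarefree and occupies
    every class, so six terms leave only the primes 2, 3, 5. What survives is 1 + z + z^2 + z^3 +
    z^4 = 0 with 1 replaced by - w - w^2. The summand - rho w is told apart from the other two by
    its fifth power. *)

Local Notation pQtoC := (map_poly (ratr : rat -> algC)).

(** * Degrees over Q in terms of conjugates *)

Lemma fmorph_horner_rat (L : fieldExtType rat) (f : {rmorphism L -> algC})
    (p : {poly rat}) x :
  f (map_poly (in_alg L) p).[x] = (pQtoC p).[f x].
Proof.
rewrite -horner_map -map_poly_comp; congr _.[_].
by apply: eq_map_poly => a /=; rewrite alg_num_field fmorph_rat.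
Qed.

Lemma aut_horner_rat (u : {rmorphism algC -> algC}) (p : {poly rat}) x :
  u (pQtoC p).[x] = (pQtoC p).[u x].
Proof.
rewrite -horner_map -map_poly_comp; congr _.[_].
by apply: eq_map_poly => a /=; rewrite fmorph_rat.
Qed.

Lemma Q_subP x y : reflect (exists p, x = (pQtoC p).[y]) (Q_sub x y).
Proof.
rewrite /Q_sub; case: num_field_exists => L [f [[|u [|v []]] //= [<- <-] _]].
apply: (iffP idP) => [/FadjoinP[_ /Fadjoin1_polyP[p ->]]|[p]].
  by exists p; rewrite fmorph_horner_rat.
rewrite -fmorph_horner_rat => /fmorph_inj ->.
by apply/FadjoinP; rewrite sub1v; split=> //; apply/Fadjoin1_polyP; exists p.
Qed.

Lemma prim_rootE n : (0 < n)%N -> n.-primitive_root (prim_root n).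
Proof.
by case: n => // n _; rewrite /prim_root; case: C_prim_root_exists.
Qed.

(* The conjugates of z over Q(alpha) are the roots of its minimal polynomial
   there, and z ^+ k is one of them iff alpha = p.[z ^+ k]. *)
Lemma Q_degree_prim_root n (z alpha : algC) (p : {poly rat}) :
    n.-primitive_root z -> alpha = (pQtoC p).[z] ->
  Q_degree z alpha
    = #|[set k : 'I_n | coprime k n && ((pQtoC p).[z ^+ k] == alpha)]|.
Proof.
move=> prim_z Dalpha; rewrite /Q_degree.
case: num_field_exists => L [f [[|u [|v []]] //= [Du Dv] _]].
set A := <<1; u>>%AS.
have Au : u \in A by apply: memv_adjoin.
have Duv : u = (map_poly (in_alg L) p).[v].
  by apply: (fmorph_inj f); rewrite fmorph_horner_rat Du Dv.
have DE : <<1; v>>%VS = <<A; v>>%VS.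
  apply/eqP; rewrite eqEsubv; apply/andP; split; apply/FadjoinP; split.
  - exact: sub1v.
  - exact: memv_adjoin.
  - apply/FadjoinP; rewrite sub1v; split=> //.
    by apply/Fadjoin1_polyP; exists p.
  - exact: memv_adjoin.
rewrite DE -adjoin_degreeE.
pose q := map_poly f (minPoly A v).
have q_monic : q \is monic by rewrite monic_map ?monic_minPoly.
have root_q k : root q (z ^+ k) -> (pQtoC p).[z ^+ k] = alpha.
  move=> qk0; have: minPoly A v %| map_poly (in_alg L) p - u%:P.
    apply: minPoly_dvdp; last by rewrite rootE !hornerE -Duv subrr.
    rewrite rpredB ?polyOverC //; apply/polyOverP=> i; rewrite coef_map /=.
    by rewrite rpredZ ?rpred1.
  rewrite -(dvdp_map f) -/q => /dvdpP[r] /(congr1 (fun s => s.[z ^+ k])).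
  rewrite !hornerE (rootP qk0) mulr0 rmorphB /= map_polyC /= Du.
  rewrite -map_poly_comp !hornerE => /eqP.
  rewrite subr_eq0 => /eqP <-; congr _.[_].
  by apply: eq_map_poly => a /=; rewrite alg_num_field fmorph_rat.
(* An automorphism taking [z] to [z ^+ k] fixes [alpha], hence the image of [A] and the coefficients
   of [q], so it carries the root [z] of [q] to [z ^+ k]. *)
have sub_root k : coprime k n -> (pQtoC p).[z ^+ k] = alpha -> root q (z ^+ k).
  move=> co_kn pk; case: (Qn_aut_exists co_kn) => g Dg.
  have gz : g z = z ^+ k by rewrite Dg ?(prim_expr_order prim_z).
  have gfA a : a \in A -> g (f a) = f a.
    case/Fadjoin1_polyP=> r ->; rewrite fmorph_horner_rat Du aut_horner_rat.
    by rewrite {1}Dalpha aut_horner_rat gz pk.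
  have <- : map_poly g q = q.
    apply/polyP=> i; rewrite !coef_map /= gfA //.
    exact: (polyOverP (minPolyOver A v)).
  by rewrite -gz fmorph_root -Dv fmorph_root root_minPoly.
have: q %| cyclotomic z n.
  have DPhi : cyclotomic z n
      = map_poly f (map_poly (in_alg L) (map_poly intr 'Phi_n)).
    rewrite -(Cintr_Cyclotomic prim_z) -!map_poly_comp.
    by apply: eq_map_poly => a /=; rewrite alg_num_field fmorph_rat ratr_int.
  rewrite DPhi dvdp_map; apply: minPoly_dvdp.
    by apply/polyOverP=> i; rewrite coef_map /= rpredZ ?rpred1.
  by rewrite -(fmorph_root f) Dv -DPhi root_cyclotomic.
rewrite /cyclotomic -big_filter => /dvdp_prod_XsubC[m].
rewrite eqp_monic ?monic_prod_XsubC // => /eqP Dq.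
have ->: adjoin_degree A v = (size q).-1.
  by rewrite size_map_poly size_minPoly.
rewrite Dq size_prod_XsubC /=; set s := [seq _ <- _ | _] in Dq *.
have uniq_m : uniq (mask m s) by rewrite mask_uniq // filter_uniq ?index_enum_uniq.
rewrite -(card_uniqP uniq_m) cardsE; apply: eq_card => k.
rewrite -[RHS]topredE /=; apply/esym/(sameP andP)/(iffP idP) => [ks | [co_kn /eqP]].
  have := mem_mask ks; rewrite mem_filter => /andP[-> _]; split=> //.
  apply/eqP/root_q; rewrite Dq -(big_map (fun i : 'I_n => z ^+ i) xpredT
    (fun x => 'X - x%:P)) root_prod_XsubC.
  exact: map_f.
move/(sub_root _ co_kn); rewrite Dq -(big_map (fun i : 'I_n => z ^+ i) xpredT
    (fun x => 'X - x%:P)) root_prod_XsubC => /mapP[l ls /eqP].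
rewrite (eq_prim_root_expr prim_z) !modn_small // => /eqP/val_inj -> //.
Qed.

(** * Averaging over the p-th roots of unity *)

Lemma sum_unity_powers p (y : algC) :
  y ^+ p = 1 -> \sum_(t < p) y ^+ t = (y == 1)%:R * p%:R.
Proof.
move=> yp; have [-> | y1] := eqVneq; rewrite ?mul1r ?mul0r.
  by under eq_bigr do rewrite expr1n; rewrite sumr_const card_ord.
apply: (mulfI (_ : y - 1 != 0)); first by rewrite subr_eq0.
by rewrite -subrX1 yp subrr mulr0.
Qed.

Lemma bad_exponent p m :
  prime p -> ~~ (p %| m)%N -> exists2 t, (t < p)%N & (p %| 1 + t * m)%N.
Proof.
move=> p_pr p'm; have p_gt0 := prime_gt0 p_pr.
have m_gt0 : (0 < m)%N by case: m p'm => //; rewrite dvdn0.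
have [u v Duv _] := egcdnP p m_gt0.
have gcd1 : gcdn m p = 1%N by apply/eqP;
  rewrite -/(coprime m p) coprime_sym prime_coprime.
exists ((p.-1 * u) %% p)%N; first by rewrite ltn_mod.
rewrite /dvdn -modnDmr modnMml modnDmr -/(dvdn _ _) -mulnA Duv gcd1.
by rewrite mulnDr muln1 addnCA add1n prednK // dvdn_add // mulnA dvdn_mull.
Qed.

(* Fourier inversion over the p-th roots of unity w: the automorphisms
   z |-> z ^+ (1 + t * m), m := M %/ p, scale the w-class by w ^+ t. They exist
   for every t if p divides m, and for all t but one otherwise; S accounts for
   the missing one. *)
Lemma class_sums (I : finType) (x : I -> algC) M p (beta := \sum_i x i) :
    prime p -> (p %| M)%N -> (0 < M)%N -> (forall i, x i ^+ M = 1) ->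
    (forall u : {rmorphism algC -> algC},
       (forall z, z ^+ (M %/ p) = 1 -> u z = z) -> u beta = beta) ->
  exists t S,
    [/\ (p %| M %/ p)%N -> S = 0,
        ~~ (p %| M %/ p)%N -> (p %| 1 + t * (M %/ p))%N
      & forall w, w ^+ p = 1 ->
          \sum_(i | x i ^+ (M %/ p) == w) x i
            = (w == 1)%:R * beta + w ^- t * S].
Proof.
move=> p_pr p_M M_gt0 xM fix_beta; set m := (M %/ p)%N in fix_beta *.
have DM : M = (m * p)%N by rewrite divnK.
have p_gt0 := prime_gt0 p_pr.
have p_neq0 : p%:R != 0 :> algC by rewrite pnatr_eq0 -lt0n.
pose T t := \sum_i x i ^+ (1 + t * m).
have T_good t : (p %| m)%N || ~~ (p %| 1 + t * m)%N -> T t = beta.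
  move=> good_t.
  have co_t : coprime (1 + t * m) M.
    have co_m : coprime (1 + t * m) m.
      by rewrite /coprime addnC gcdnC gcdnMDl gcdn1.
    rewrite DM coprimeMr co_m coprime_sym prime_coprime //=.
    case/orP: good_t => // p_m.
    by apply: contraL p_m => p_t; rewrite -prime_coprime // (coprime_dvdl p_t).
  have [u Du] := Qn_aut_exists co_t.
  rewrite -[RHS](fix_beta u) => [|z zm].
    by rewrite rmorph_sum; apply: eq_bigr => i _; rewrite Du.
  by rewrite Du ?DM ?exprM ?zm ?expr1n // exprD mulnC exprM zm expr1n mulr1.
have Fourier w : w ^+ p = 1 ->
  \sum_(i | x i ^+ m == w) x i = p%:R^-1 * \sum_(t < p) w ^- t * T t.
  move=> wp; have w_neq0 : w != 0.
    by apply: contra_eqN wp => /eqP->; rewrite expr0n eqn0Ngt p_gt0 eq_sym oner_eq0.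
  under [in RHS]eq_bigr do rewrite mulr_sumr.
  rewrite exchange_big /= mulr_sumr big_mkcond; apply: eq_bigr => i _ /=.
  have -> : \sum_(t < p) w ^- t * x i ^+ (1 + t * m)
              = x i * \sum_(t < p) (x i ^+ m / w) ^+ t.
    rewrite mulr_sumr; apply: eq_bigr => t _.
    by rewrite exprD expr1 mulrCA exprMn exprVn -exprM mulnC [_^-1 * _]mulrC.
  rewrite sum_unity_powers; last by rewrite exprMn exprVn -exprM -DM xM wp invr1 mulr1.
  rewrite -[_ / w == 1](inj_eq (mulIf w_neq0)) divfK // mul1r.
  case: eqP => _; last by rewrite mul0r !mulr0.
  by rewrite mul1r mulrC mulfK.
have sum_w w : w ^+ p = 1 -> \sum_(t < p) w ^- t * beta = (w == 1)%:R * beta * p%:R.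
  move=> wp; rewrite -mulr_suml; under eq_bigr do rewrite -exprVn.
  by rewrite sum_unity_powers ?exprVn ?wp ?invr1 // invr_eq1 mulrAC.
have [p_m | p'm] := boolP (p %| m)%N.
  exists 0%N, 0; split=> // w wp; rewrite mulr0 addr0 Fourier //.
  under eq_bigr do rewrite T_good ?p_m //.
  by rewrite sum_w // mulrC mulfK.
have [t0 lt_t0 p_t0] := bad_exponent p_pr p'm.
(* [t0] is the only t < p for which 1 + t * m is not prime to [M]; [S] measures how far [T t0] is
   from [beta]. *)
exists t0, (p%:R^-1 * (T t0 - beta)); split=> // w wp.
rewrite Fourier //.
have -> : \sum_(t < p) w ^- t * T t
  = \sum_(t < p) w ^- t * beta + w ^- t0 * (T t0 - beta).
  rewrite (bigD1 (Ordinal lt_t0)) //= [in RHS](bigD1 (Ordinal lt_t0)) //=.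
  rewrite mulrBr addrAC addrCA subrr addr0; congr (_ + _).
  apply: eq_bigr => t; rewrite -val_eqE /= => t_t0; rewrite T_good //.
  rewrite (negPf p'm) /=; apply: contra t_t0 => p_t.
  wlog le_t : t t0 lt_t0 p_t0 p_t / (t <= t0)%N.
    move=> IH; case: (leqP t t0) => [|/ltnW] le_t; first exact: IH le_t.
    by rewrite eq_sym; apply: (IH (Ordinal lt_t0) t).
  have : (p %| (t0 - t) * m)%N by rewrite mulnBl -(subnDl 1) dvdn_sub.
  rewrite Euclid_dvdM // (negPf p'm) orbF => /dvdn_leq; rewrite subn_gt0 => p_le.
  rewrite eqn_leq le_t /= leqNgt; apply/negP => /p_le; rewrite leqNgt.
  by rewrite (leq_ltn_trans (leq_subr _ _) lt_t0).
by rewrite sum_w // mulrDr mulrC mulfK // mulrCA.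
Qed.

(** * Roots of unity and shortest representations *)

Lemma root_of_unityP x : root_of_unity x <-> exists2 n, (0 < n)%N & x ^+ n = 1.
Proof. by split=> -[n n_gt0 /unity_rootP xn]; exists n. Qed.

Lemma root_of_unity_prim n x : n.-primitive_root x -> root_of_unity x.
Proof.
move=> prim_x; apply/root_of_unityP; exists n; first exact: prim_order_gt0 prim_x.
exact: prim_expr_order.
Qed.

Lemma root_of_unityM x y : root_of_unity x -> root_of_unity y -> root_of_unity (x * y).
Proof.
move=> /root_of_unityP[m m_gt0 xm] /root_of_unityP[n n_gt0 yn].
apply/root_of_unityP; exists (m * n)%N; first by rewrite muln_gt0 m_gt0.
by rewrite exprMn exprM xm expr1n mulnC exprM yn expr1n mulr1.
Qed.

Lemma root_of_unityN1 : root_of_unity (-1).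
Proof. by apply/root_of_unityP; exists 2; rewrite // sqrrN expr1n. Qed.

Lemma root_of_unityN x : root_of_unity x -> root_of_unity (- x).
Proof. by rewrite -mulN1r; apply/root_of_unityM/root_of_unityN1. Qed.

Lemma root_of_unityX x n : root_of_unity x -> root_of_unity (x ^+ n).
Proof.
move=> /root_of_unityP[m m_gt0 xm]; apply/root_of_unityP; exists m => //.
by rewrite exprAC xm expr1n.
Qed.

Lemma root_of_unityV x : root_of_unity x -> root_of_unity x^-1.
Proof.
move=> /root_of_unityP[m m_gt0 xm]; apply/root_of_unityP; exists m => //.
by rewrite exprVn xm invr1.
Qed.

Lemma root_of_unity_aut (u : {rmorphism algC -> algC}) x :
  root_of_unity x -> root_of_unity (u x).
Proof.
move=> /root_of_unityP[m m_gt0 xm]; apply/root_of_unityP; exists m => //.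
by rewrite -rmorphXn xm rmorph1.
Qed.

Lemma root_of_unity_norm x : root_of_unity x -> `|x| = 1.
Proof.
move=> /root_of_unityP[m m_gt0 xm]; apply/eqP.
by rewrite -(@pexpr_eq1 _ _ m) ?normr_ge0 // -normrX xm normr1.
Qed.

Lemma root_of_unity_neq0 x : root_of_unity x -> x != 0.
Proof. by move/root_of_unity_norm=> x1; rewrite -normr_eq0 x1 oner_eq0. Qed.

Lemma has_weight_sum (I : finType) (x : I -> algC) (A : {set I}) :
  (forall i, root_of_unity (x i)) -> has_weight (\sum_(i in A) x i) #|A|.
Proof.
by move=> x_unit; exists (fun i => x (enum_val i)) => //; apply: big_enum_val.
Qed.

Definition shortest (I : finType) (x : I -> algC) :=
  (forall i, root_of_unity (x i)) /\
  forall k, has_weight (\sum_i x i) k -> (#|I| <= k)%N.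

Lemma shortest_leq (I J : finType) (x : I -> algC) (y : J -> algC) (A : {set J}) :
    shortest x -> (forall j, root_of_unity (y j)) ->
  \sum_i x i = \sum_(j in A) y j -> (#|I| <= #|A|)%N.
Proof. by case=> _ x_min y_unit Dx; apply: x_min; rewrite Dx; apply: has_weight_sum. Qed.

(** Minimality is mostly used in this form: an equal sum of roots of unity over fewer indices would
    be shorter. *)
Lemma shortest_full (I : finType) (x y : I -> algC) (P : pred I) :
    shortest x -> (forall i, root_of_unity (y i)) ->
  \sum_i x i = \sum_(i | P i) y i -> forall i, P i.
Proof.
move=> x_short y_unit Dx i.
have : (#|I| <= #|[set j | P j]|)%N.
  by apply: (shortest_leq x_short y_unit); rewrite Dx; apply: eq_bigl => j; rewrite inE.
rewrite -cardsT => /(conj (subsetT [set j | P j]))/andP;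
  rewrite -eqEcard => /eqP/setP/(_ i).
by rewrite !inE.
Qed.

Lemma common_order (I : finType) (x : I -> algC) :
    (forall i, root_of_unity (x i)) ->
  exists2 m, (0 < m)%N & forall i, x i ^+ m = 1.
Proof.
move=> x_unit; have ex_m i : exists m, (0 < m)%N && (x i ^+ m == 1).
  by have /root_of_unityP[m m_gt0 xm] := x_unit i; exists m; rewrite m_gt0 xm eqxx.
exists (\prod_i xchoose (ex_m i)).
  by rewrite prodn_gt0 // => i; case/andP: (xchooseP (ex_m i)).
move=> i; rewrite (bigD1 i) //= exprM; case/andP: (xchooseP (ex_m i)) => _ /eqP->.
by rewrite expr1n.
Qed.

(** Only [q] is minimised. With L = 1 it is the least common order; in general it measures how far
    the [x i] are from being [L]-th roots of unity. *)
Lemma min_common_order (I : finType) (x : I -> algC) L :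
    (0 < L)%N -> (forall i, root_of_unity (x i)) ->
  exists2 q, (0 < q)%N /\ (forall i, x i ^+ (q * L) = 1)
    & forall p, prime p -> (p %| q)%N -> exists i, x i ^+ (q * L %/ p) != 1.
Proof.
move=> L_gt0 x_unit.
have ex_q : exists q, (0 < q)%N && [forall i, x i ^+ (q * L) == 1].
  have [m m_gt0 xm] := common_order x_unit; exists m; rewrite m_gt0.
  by apply/forallP=> i; rewrite exprM xm expr1n.
case: (ex_minnP ex_q) => q /andP[q_gt0 /forallP xq] q_min.
exists q; first by split=> // i; apply/eqP.
move=> p p_pr p_q; apply/existsP; rewrite -negb_forall; apply/negP=> /forallP xp.
suffices /q_min : (0 < q %/ p)%N && [forall i, x i ^+ (q %/ p * L) == 1].
  by rewrite leqNgt ltn_Pdiv ?prime_gt1.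
rewrite divn_gt0 ?prime_gt0 // dvdn_leq //=.
by apply/forallP=> i; rewrite divn_mulAC.
Qed.

(** Otherwise a prime [p] divides the excess [q]. If [S] is 0, the class of 1 carries the whole sum,
    hence is everything by minimality, against the choice of [q]. If not, [p] does not divide [m],
    so it is odd because 2 divides [m]; the classes of 1 and [w] alone then suffice to write the
    sum, and the class of [w ^+ 2] is empty although its sum is nonzero. *)
Lemma shortest_in_field (I : finType) (x : I -> algC) n :
    (0 < n)%N -> shortest x ->
    (forall u : {rmorphism algC -> algC},
      (forall z, z ^+ n = 1 -> u z = z) -> u (\sum_i x i) = \sum_i x i) ->
  forall i, x i ^+ lcmn 2 n = 1.
Proof.
move=> n_gt0 x_short fix_x; have [x_unit x_min] := x_short.
set L := lcmn 2 n; have L_gt0 : (0 < L)%N by rewrite lcmn_gt0.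
have [q [q_gt0 xq] q_min] := min_common_order L_gt0 x_unit.
have [q_le1 | q_gt1] := leqP q 1.
  by have q1 : q = 1%N; [apply/eqP; rewrite eqn_leq q_le1 | rewrite q1 mul1n in xq].
have [p p_pr p_q] := pdivP q_gt1.
have L_m : (L %| q * L %/ p)%N by rewrite -divn_mulAC // dvdn_mull.
have [i xi_m] := q_min p p_pr p_q.
set M := (q * L)%N in xq L_m xi_m *; set m := (M %/ p)%N in L_m xi_m *.
have [|||u fix_u|t [S []]] := @class_sums _ x M p p_pr.
- by rewrite dvdn_mulr.
- by rewrite muln_gt0 q_gt0.
- exact: xq.
- apply: fix_x => z zn; apply: fix_u.
  by rewrite -/m; have /dvdnP[k ->] := dvdn_trans (dvdn_lcmr 2 n) L_m;
    rewrite mulnC exprM zn expr1n.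
rewrite -/m => S0 _ sums; have sum1 := sums 1 (expr1n _ _);
  rewrite eqxx mul1r expr1n invr1 mul1r in sum1.
have S_neq0 : S != 0.
  apply: contraNneq xi_m => S_eq0; rewrite S_eq0 addr0 in sum1.
  exact: (shortest_full (P := fun j => x j ^+ m == 1) x_short x_unit).
have p'm : ~~ (p %| m)%N by apply: contra S_neq0 => /S0->.
have p_gt2 : (2 < p)%N.
  rewrite ltn_neqAle prime_gt1 // andbT; apply: contraNneq p'm => <-.
  exact: dvdn_trans (dvdn_lcml 2 n) L_m.
have [w prim_w] := C_prim_root_exists (prime_gt0 p_pr).
have wp := prim_expr_order prim_w.
have w_neq1 : w != 1 by rewrite -(prim_order_dvd prim_w 1) dvdn1 neq_ltn prime_gt1 ?orbT.
have w2_neq1 : w ^+ 2 != 1.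
  by rewrite -(prim_order_dvd prim_w) gtnNdvd.
have w2_neqw : w ^+ 2 != w.
  by rewrite -[X in _ != X]expr1 (eq_prim_root_expr prim_w) !modn_small // ltnW.
have sumw := sums w wp; rewrite (negPf w_neq1) mul0r add0r in sumw.
have w2p : (w ^+ 2) ^+ p = 1 by rewrite exprAC wp expr1n.
have sumw2 := sums _ w2p; rewrite (negPf w2_neq1) mul0r add0r in sumw2.
pose y j := if x j ^+ m == 1 then x j else - (w ^+ t) * x j.
have y_unit j : root_of_unity (y j).
  rewrite /y; case: ifP => // _; apply: root_of_unityM => //.
  exact/root_of_unityN/root_of_unityX/(root_of_unity_prim prim_w).
pose P j := (x j ^+ m == 1) || (x j ^+ m == w).
have Dy : \sum_i x i = \sum_(i | P i) y i.
  rewrite [RHS](bigID (fun i => x i ^+ m == 1)) /=.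
  have -> : \sum_(i | P i && (x i ^+ m == 1)) y i = \sum_(i | x i ^+ m == 1) x i.
    apply: eq_big => j; first by rewrite /P; case: eqP; rewrite ?andbF.
    by rewrite /y => /andP[_ ->].
  have -> : \sum_(i | P i && (x i ^+ m != 1)) y i
              = \sum_(i | x i ^+ m == w) - (w ^+ t) * x i.
    apply: eq_big => j; last by rewrite /y => /andP[_ /negPf->].
    by rewrite /P; case: (x j ^+ m =P 1) => [->|];
      rewrite ?andbF ?andbT // eq_sym (negPf w_neq1).
  rewrite -mulr_sumr sum1 sumw mulNr mulVKf ?addrK //.
  by rewrite expf_neq0 // (root_of_unity_neq0 (root_of_unity_prim prim_w)).
have full := shortest_full x_short y_unit Dy.
case/eqP: S_neq0; apply: (mulfI (_ : (w ^+ 2) ^- t != 0)).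
  by rewrite invr_eq0 !expf_neq0 // (root_of_unity_neq0 (root_of_unity_prim prim_w)).
rewrite mulr0 -sumw2 big_pred0 // => j; apply/negP=> /eqP xj.
by have := full j; rewrite /P xj (negPf w2_neq1) (negPf w2_neqw).
Qed.

(** * Minimal vanishing sums of six roots of unity *)

Definition minimal_vanishing (I : finType) (x : I -> algC) :=
  \sum_i x i = 0 /\
  forall A : {set I}, A != set0 -> \sum_(i in A) x i = 0 -> A = setT.

(** If [S] vanished, the class of [x j] would be a nonempty vanishing subsum missing [i]. The
    exponent 1 + t * (M %/ p) multiplies the terms of the class of [w] by [w ^+ t]: this equalises
    the class sums and, [p] dividing the exponent, leaves (M %/ p)-th roots of unity. *)
Lemma minimal_vanishing_classes (I : finType) (x : I -> algC) M p i j :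
    minimal_vanishing x -> prime p -> (p %| M)%N -> (0 < M)%N ->
    (forall i, x i ^+ M = 1) -> x i ^+ (M %/ p) != x j ^+ (M %/ p) ->
  ~~ (p %| M %/ p)%N /\
  exists t S,
    [/\ S != 0, (p %| 1 + t * (M %/ p))%N
      & forall w, w ^+ p = 1 ->
          \sum_(i | x i ^+ (M %/ p) == w) x i ^+ (1 + t * (M %/ p)) = S].
Proof.
move=> [sum0 x_min] p_pr p_M M_gt0 xM; set m := (M %/ p)%N => x_ij.
have [|t [S []]] := @class_sums _ x M p p_pr p_M M_gt0 xM.
  by move=> u _; rewrite sum0 rmorph0.
rewrite -/m sum0 => S0 p_t sums.
have wp k : (x k ^+ m) ^+ p = 1 by rewrite -exprM divnK.
have S_neq0 : S != 0.
  apply: contraNneq x_ij => S_eq0.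
  have := x_min [set k | x k ^+ m == x j ^+ m].
  rewrite (eq_bigl (fun k => x k ^+ m == x j ^+ m)) => [|k]; last by rewrite inE.
  rewrite sums // S_eq0 !mulr0 addr0 => /(_ _ (erefl _))/setP H.
  have: i \in setT by []; rewrite -H ?inE //.
  by apply/set0Pn; exists j; rewrite inE.
have p'm : ~~ (p %| m)%N by apply: contra S_neq0 => /S0->.
split=> //; exists t, S; split=> // [|w w1]; first exact: p_t.
have w_neq0 : w != 0.
  by apply: contra_eqN w1 => /eqP->; rewrite expr0n eqn0Ngt prime_gt0 // eq_sym oner_eq0.
have := sums w w1; rewrite mulr0 add0r => /(congr1 ( *%R (w ^+ t))).
rewrite mulVKf ?expf_neq0 // mulr_sumr => <-.
by apply: eq_bigr => k /eqP Dw; rewrite exprD expr1 mulnC exprM Dw mulrC.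
Qed.

Lemma dvdn_two m :
    (0 < m)%N -> ~~ (4 %| m)%N ->
  (forall p, prime p -> (p %| m)%N -> p = 2%N) -> (m %| 2)%N.
Proof.
move=> m_gt0 m4 pr_m; have [m_le1 | m_gt1] := leqP m 1.
  by rewrite (_ : m = 1%N) //; apply/eqP; rewrite eqn_leq m_le1.
have [p p_pr p_m] := pdivP m_gt1.
have /dvdnP[k Dm] : (2 %| m)%N by rewrite -(pr_m p).
rewrite Dm in m4 m_gt0 pr_m *; have [k_le1 | k_gt1] := leqP k 1.
  by case: k k_le1 {Dm m4 pr_m} m_gt0 => [|[]].
have [q q_pr q_k] := pdivP k_gt1.
case/negP: m4; rewrite -[4%N]/(2 * 2)%N dvdn_pmul2r //.
by rewrite -(pr_m q) // dvdn_mulr.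
Qed.

(* x i and x j are the two primitive sixth roots of unity times rho, and stand
   for the term rho of the vanishing sum of the five fifth roots of rho ^+ 5. *)
Definition fifth_roots_shape (I : eqType) (x : I -> algC) (rho : algC) (i j : I) :=
  [/\ i != j, root_of_unity rho, x i + x j = rho,
      forall k, k != i -> k != j -> x k ^+ 5 = rho ^+ 5 /\ x k != rho
    & forall k l, k != i -> k != j -> l != i -> l != j -> x k = x l -> k = l].

Section SixTerms.

Variables (I : finType) (x : I -> algC).
Hypotheses (card_I : #|I| = 6%N) (x_unit : forall i, root_of_unity (x i)).

Lemma class_section m p (z : algC) (P : I -> Prop) :
    p.-primitive_root z ->
    (forall w, w ^+ p = 1 -> exists2 i, x i ^+ m = w & P i) ->
  exists2 f : 'I_p -> I, injective f & forall k, x (f k) ^+ m = z ^+ k /\ P (f k).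
Proof.
move=> prim_z sec.
have [k|f Df] := @fin_all_exists _ _ (fun k : 'I_p => fun i => x i ^+ m = z ^+ k /\ P i).
  have [|i xi Pi] := sec (z ^+ k); last by exists i.
  by rewrite exprAC (prim_expr_order prim_z) expr1n.
exists f => // k l Dfk; apply/val_inj/eqP; have [/eqP + _] := Df k.
by rewrite Dfk (Df l).1 (eq_prim_root_expr prim_z) !modn_small // eq_sym.
Qed.

Hypothesis x_min : minimal_vanishing x.

(** Six terms equal to 1 do not add up to 0, so some term is -1, and together with [x i] it is a
    proper vanishing subsum. *)
Lemma six_terms_not_two i : x i = 1 -> ~ (forall j, x j ^+ 2 = 1).
Proof.
move=> xi x2; have [j xj] : exists j, x j = -1.
  have [j /eqP xj | x_N1] := pickP (fun j => x j == -1); first by exists j.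
  have /eqP := x_min.1; rewrite (eq_bigr (fun _ => 1)) => [|j _].
    by rewrite sumr_const card_I pnatr_eq0.
  by have /eqP := x2 j; rewrite sqrf_eq1 x_N1 orbF => /eqP.
have /eqP : [set i; j] = setT.
  apply: x_min.2; first by apply/set0Pn; exists i; rewrite set21.
  rewrite big_setU1 /= ?big_set1 ?xi ?xj ?subrr // inE; apply/eqP=> Dij.
  have /eqP := xj; rewrite -Dij xi -subr_eq0 opprK -(natrD _ 1 1) pnatr_eq0 //.
by rewrite eqEcard cardsT card_I cards2; case: (_ != _); rewrite andbF.
Qed.

(** Otherwise the [x k ^+ e] are 1 or -1, with the same nonzero sum [S] in each of the three
    classes. Each class then has a term with the sign of [S], and three such terms form, up to sign,
    the sum of the three cube roots of unity, a proper vanishing subsum. *)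
Lemma six_terms_not_three M :
    (0 < M)%N -> (forall i, x i ^+ M = 1) -> (3 %| M)%N -> (M %/ 3 %| 2)%N ->
  forall i j, x i ^+ (M %/ 3) = x j ^+ (M %/ 3).
Proof.
move=> M_gt0 xM M3 m2 i j; set m := (M %/ 3)%N in m2 *.
apply/eqP/negPn/negP => x_ij.
have [_ [t [S []]]] := minimal_vanishing_classes x_min (isT : prime 3) M3 M_gt0 xM x_ij.
rewrite -/m; set e := (1 + t * m)%N => S_neq0 t3 sums.
have y2 k : x k ^+ e = 1 \/ x k ^+ e = -1.
  have /eqP : (x k ^+ e) ^+ 2 = 1.
    rewrite -exprM; have /dvdnP[r ->] : (M %| e * 2)%N.
      by rewrite -(divnK M3) -/m mulnC dvdn_mul.
    by rewrite mulnC exprM xM expr1n.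
  by rewrite sqrf_eq1 => /orP[]/eqP; [left | right].
have S_real : S \is Num.real.
  rewrite -(sums 1 (expr1n _ _)); apply: rpred_sum => k _.
  by case: (y2 k) => ->; rewrite ?rpredN ?rpred1.
have [s Ds sS] : exists2 s, s = 1 \/ s = -1 & 0 < s * S.
  have [S_gt0 | S_lt0 | S0] := real_ltgt0P S_real; last by rewrite S0 eqxx in S_neq0.
    by exists 1; [left | rewrite mul1r].
  by exists (-1); [right | rewrite mulN1r oppr_gt0].
have ss : s * s = 1 by case: Ds => ->; rewrite ?mulrNN mul1r.
have sec w : w ^+ 3 = 1 -> exists2 k, x k ^+ m = w & x k ^+ e = s.
  move=> w3; have [k /andP[/eqP ? /eqP ?] | no_s] :=
    pickP (fun k => (x k ^+ m == w) && (x k ^+ e == s)); first by exists k.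
  have := sS; rewrite -(sums w w3) mulr_sumr le_gtF //.
  apply: sumr_le0 => k xk; have := no_s k; rewrite xk /= => /eqP y_s.
  have -> : x k ^+ e = - s by case: (y2 k) Ds y_s => -> [] ->; rewrite ?opprK.
  by rewrite mulrN ss oppr_le0 ler01.
have [z prim_z] := C_prim_root_exists (isT : (0 < 3)%N).
have [f inj_f Df] := class_section prim_z sec.
have z_neq0 : z != 0 by apply: (root_of_unity_neq0 (root_of_unity_prim prim_z)).
have /eqP : f @: setT = setT.
  apply: x_min.2; first by apply/set0Pn; exists (f ord0); rewrite imset_f.
  rewrite big_imset; last by move=> k l _ _; apply: inj_f.
  rewrite (eq_bigr (fun k : 'I_3 => s * (z ^- t) ^+ k)) => [|k _].
    rewrite big_mkcond (eq_bigr (fun k : 'I_3 => s * (z ^- t) ^+ k)) => [|k _];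
      last by rewrite inE.
    rewrite -mulr_sumr sum_unity_powers; last first.
      by rewrite -exprVn exprAC exprVn (prim_expr_order prim_z) invr1 expr1n.
    rewrite invr_eq1 -(prim_order_dvd prim_z); have /negPf-> : ~~ (3 %| t)%N.
      by apply: contraL t3 => t3; rewrite dvdn_addl ?dvdn_mulr.
    by rewrite mul0r mulr0.
  have [xm xe] := Df k; rewrite -xe /e exprD expr1 mulnC exprM xm.
  by rewrite exprAC -mulrA -exprMn mulfV ?expr1n ?mulr1 // expf_neq0.
by rewrite eqEcard subsetT card_imset // !cardsT card_I card_ord.
Qed.

(** Six terms occupy five classes, so one class has two terms and the others one each. A class with
    a single term shows that [S] is a root of unity; the two terms of the double class add up to
    [rho], the value that a single term would have there. *)
Lemma six_terms_five M i0 i1 :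
    (0 < M)%N -> (forall i, x i ^+ M = 1) -> (5 %| M)%N ->
    x i0 ^+ (M %/ 5) != x i1 ^+ (M %/ 5) ->
  exists rho i j, fifth_roots_shape x rho i j.
Proof.
move=> M_gt0 xM M5 x01.
have [_ [t [S []]]] := minimal_vanishing_classes x_min (isT : prime 5) M5 M_gt0 xM x01.
set m := (M %/ 5)%N; set e := (1 + t * m)%N => S_neq0 t5 sums.
have [z prim_z] := C_prim_root_exists (isT : (0 < 5)%N).
have zz k l : (z ^+ k == z ^+ l) = (k == l %[mod 5]) by apply: eq_prim_root_expr.
have z5 k : (z ^+ k) ^+ 5 = 1 by rewrite exprAC (prim_expr_order prim_z) expr1n.
have [w wp|f inj_f Df] := @class_section m 5 z (fun _ => True) prim_z.
  have [k /eqP xk|none] := pickP (fun k => x k ^+ m == w); first by exists k.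
  by case/eqP: S_neq0; rewrite -(sums w wp) big_pred0.
have {}Df k : x (f k) ^+ m = z ^+ k by case: (Df k).
have x_neq0 k : x k != 0 := root_of_unity_neq0 (x_unit k).
have Dx k : x k = x k ^+ e / (x k ^+ m) ^+ t.
  by rewrite /e exprD expr1 mulnC exprM mulfK // !expf_neq0.
have x5 k : (x k ^+ m) ^+ 5 = 1 by rewrite -exprM divnK.
have /cards1P[i Di] : #|~: (f @: setT)| == 1%N.
  by rewrite cardsCs setCK card_imset // cardsT card_I card_ord.
have notin_f k : k != i -> exists l, k = f l.
  move=> k_i; have: k \in f @: setT by rewrite -[_ @: _]setCK Di !inE k_i.
  by case/imsetP=> l _ ->; exists l.
have fi l : f l != i.
  have: f l \notin ~: (f @: setT) by rewrite inE negbK imset_f.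
  by rewrite Di inE.
have [k0 Dk0] := prim_rootP prim_z (x5 i).
have zinj (k l : 'I_5) : z ^+ k = z ^+ l -> k = l.
  by move=> /eqP; rewrite zz !modn_small // => /eqP/val_inj.
have class_f l k : l != k0 -> x k ^+ m == z ^+ l -> k = f l.
  move=> l_k0 /eqP xk; have [k_i | /notin_f[k' Dk]] := eqVneq k i.
    by case/eqP: l_k0; apply: zinj; rewrite -Dk0 -xk k_i.
  by rewrite Dk; congr f; apply: zinj; rewrite -Df -xk Dk.
have DS l : l != k0 -> x (f l) ^+ e = S.
  move=> l_k0; rewrite -(sums _ (z5 l)) (big_pred1 (f l)) // => k.
  by apply/idP/eqP => [/class_f-> | ->] //; apply/eqP/Df.
have S_unit : root_of_unity S.
  have [l l_k0] : exists l, l != k0.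
    apply/existsP; rewrite -negb_forall; apply/negP=> /forallP k0_all.
    by have := eqP (k0_all ord0); have := eqP (k0_all ord_max) => <-.
  by rewrite -(DS l l_k0); apply: root_of_unityX.
pose rho := S / (z ^+ k0) ^+ t.
have rho_unit : root_of_unity rho.
  apply: root_of_unityM => //; apply/root_of_unityV/root_of_unityX/root_of_unityX.
  exact: root_of_unity_prim prim_z.
have z_neq0 : z != 0 by apply: (root_of_unity_neq0 (root_of_unity_prim prim_z)).
exists rho, i, (f k0); split=> //; first by rewrite eq_sym.
- rewrite Dx [x (f k0)]Dx Df Dk0 -mulrDl; congr (_ / _).
  rewrite -(sums _ (z5 k0)) (bigD1 i) ?Dk0 //= (bigD1 (f k0)) ?Df ?fi ?eqxx //=.
  rewrite big_pred0 ?addr0 // => k; apply/negP.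
  case/andP=> /andP[/eqP xk /notin_f[l Dk]] /eqP[]; rewrite Dk; congr f.
  by apply: zinj; rewrite -Df -Dk.
- move=> k /notin_f[l ->] k_k0.
  have l_k0 : l != k0 by apply: contraNneq k_k0 => ->.
  rewrite Dx DS // Df /rho !exprMn !exprVn ![(_ ^+ t) ^+ 5]exprAC !z5 !expr1n.
  split=> //; apply/eqP=> /(mulfI S_neq0)/invr_inj/(congr1 (fun u => u ^+ m)).
  (* As t * m is -1 modulo 5, the [m]-th power recovers the class from its factor. *)
  have zt (l' : nat) : ((z ^+ l') ^+ t) ^+ m = (z ^+ l')^-1.
    apply: (mulIf (_ : z ^+ l' != 0)); first exact: expf_neq0.
    rewrite mulVf ?expf_neq0 // -exprM -exprSr -[(t * m).+1]/e.
    by case/dvdnP: t5 => r ->; rewrite mulnC exprM z5 expr1n.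
  by rewrite !zt => /invr_inj/zinj/eqP; rewrite (negPf l_k0).
move=> k l /notin_f[k' ->] _ /notin_f[l' ->] _ /(congr1 (fun u => u ^+ m)).
by rewrite !Df => /zinj->.
Qed.

(** As 1 is a term, each prime p of the least common order [q] puts two terms in different classes.
    So p divides [q] only once and all p classes are occupied, whence p <= 6. Without 5, [q] would
    divide 6, and both 3 and 2 are excluded in turn. *)
Lemma six_terms_norm i0 : x i0 = 1 ->
  exists rho i j, fifth_roots_shape x rho i j.
Proof.
move=> x0.
have [q [q_gt0 xq] q_min] := min_common_order (isT : (0 < 1)%N) x_unit.
rewrite muln1 in xq q_min.
have classes p : prime p -> (p %| q)%N
  -> exists2 i, x i ^+ (q %/ p) != x i0 ^+ (q %/ p) & True.
  by move=> p_pr /(q_min p p_pr)[i xi]; exists i; rewrite // x0 expr1n.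
have not_dvd p : prime p -> (p %| q)%N -> ~~ (p %| q %/ p)%N.
  move=> p_pr p_q; have [i xi _] := classes p p_pr p_q.
  by case: (minimal_vanishing_classes x_min p_pr p_q q_gt0 xq xi).
have p_le6 p : prime p -> (p %| q)%N -> (p <= 6)%N.
  move=> p_pr p_q; have [i xi _] := classes p p_pr p_q.
  have [_ [t [S [S_neq0 _ sums]]]] := minimal_vanishing_classes x_min p_pr p_q q_gt0 xq xi.
  have [z prim_z] := C_prim_root_exists (prime_gt0 p_pr).
  have [w wp|f inj_f _] := @class_section (q %/ p) p z (fun _ => True) prim_z.
    have [k /eqP xk|none] := pickP (fun k => x k ^+ (q %/ p) == w); first by exists k.
    by case/eqP: S_neq0; rewrite -(sums w wp) big_pred0.
  by rewrite -(card_ord p) -card_I; apply: leq_card inj_f.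
have [q5 | q5'] := boolP (5 %| q)%N.
  have [i xi _] := classes 5 isT q5.
  exact: (@six_terms_five q i i0).
case: (@six_terms_not_two i0 x0) => j.
have pr_q p : prime p -> (p %| q)%N -> p = 2%N \/ p = 3%N.
  move=> p_pr p_q; have := p_le6 p p_pr p_q.
  by case: p p_pr p_q => [|[|[|[|[|[|[]]]]]]] //; [left | right | rewrite (negPf q5')].
have [q3 | q3'] := boolP (3 %| q)%N.
  have [i /eqP[]] := q_min 3 isT q3.
  rewrite -[RHS](expr1n _ (q %/ 3)) -x0; apply: six_terms_not_three => //.
  have q3_q : (q %/ 3 %| q)%N by rewrite -{2}(divnK q3) dvdn_mulr.
  apply: dvdn_two.
  - by rewrite divn_gt0 ?(dvdn_leq q_gt0).
  - apply/negP=> q4; have q4' := dvdn_trans q4 q3_q.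
    have q2 := dvdn_trans (isT : 2 %| 4)%N q4'.
    by case/negP: (not_dvd 2 isT q2); rewrite dvdn_divRL.
  move=> p p_pr p_q; have [//|p3] := pr_q p p_pr (dvdn_trans p_q q3_q).
  by case/negP: (not_dvd 3 isT q3); move: p_q; rewrite p3.
have q2 : (q %| 2)%N.
  apply: dvdn_two => // [|p p_pr p_q].
    apply/negP=> q4; have q2 := dvdn_trans (isT : 2 %| 4)%N q4.
    by case/negP: (not_dvd 2 isT q2); rewrite dvdn_divRL.
  by case: (pr_q p p_pr p_q) => // p3; rewrite -p3 p_q in q3'.
by rewrite -(divnK q2) mulnC exprM xq expr1n.
Qed.

End SixTerms.

Lemma six_term_vanishing (I : finType) (x : I -> algC) :
    #|I| = 6%N -> (forall i, root_of_unity (x i)) -> minimal_vanishing x ->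
  exists rho i j, fifth_roots_shape x rho i j.
Proof.
move=> card_I x_unit [sum0 x_min].
have /card_gt0P[i0 _] : (0 < #|I|)%N by rewrite card_I.
have x0_neq0 := root_of_unity_neq0 (x_unit i0).
pose y i := x i / x i0.
have Dx i : x i = y i * x i0 by rewrite divfK.
have y_unit i : root_of_unity (y i) by apply/root_of_unityM/root_of_unityV.
have y_min : minimal_vanishing y.
  split=> [|A A_n0]; rewrite -mulr_suml ?sum0 ?mul0r // => /eqP.
  by rewrite mulf_eq0 invr_eq0 (negPf x0_neq0) orbF => /eqP; apply: x_min.
have [rho [i [j [ij rho_unit Drho rho5 y_inj]]]] :=
  six_terms_norm card_I y_unit y_min (divff x0_neq0).
exists (rho * x i0), i, j; split=> //.
- exact: root_of_unityM rho_unit (x_unit i0).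
- by rewrite (Dx i) (Dx j) -mulrDl Drho.
- move=> k k_i k_j; have [y5 y_rho] := rho5 k k_i k_j.
  by rewrite (Dx k) exprMn y5 -exprMn (inj_eq (mulIf x0_neq0)).
by move=> k l ? ? ? ?; rewrite (Dx k) (Dx l) => /(mulIf x0_neq0); apply: y_inj.
Qed.

(** * Shortest representations of length three *)

Lemma conj_root_of_unity x : root_of_unity x -> x^* = x^-1.
Proof. by move/root_of_unity_norm=> x1; rewrite invC_norm x1 expr1n invr1 mul1r. Qed.

(** Complex conjugation inverts roots of unity: a^-1 + b^-1 = c^-1, so that a * b = c * (a + b). *)
Lemma addr_root_of_unity_mul a b c :
    root_of_unity a -> root_of_unity b -> root_of_unity c ->
  a + b = c -> a * b = c ^+ 2.
Proof.
move=> a1 b1 c1 Dc; have /(congr1 Num.conj) := Dc.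
rewrite rmorphD /= !conj_root_of_unity // => Dc'.
have [a0 b0 c0] := And3 (root_of_unity_neq0 a1) (root_of_unity_neq0 b1) (root_of_unity_neq0 c1).
apply: (mulIf (_ : c^-1 != 0)); first by rewrite invr_eq0 (negPf c0).
by rewrite expr2 mulfK // -Dc' -Dc; field; rewrite a0 b0.
Qed.

(** A nonzero sum of two roots of unity and its conjugate determine their product, so both pairs are
    the roots of one quadratic polynomial. *)
Lemma addr_root_of_unity_inj a b c d :
    root_of_unity a -> root_of_unity b -> root_of_unity c -> root_of_unity d ->
    a + b = c + d -> a + b != 0 ->
  a = c /\ b = d \/ a = d /\ b = c.
Proof.
move=> a1 b1 c1 d1 Dab ab0; have /(congr1 Num.conj) := Dab.
rewrite !rmorphD /= !conj_root_of_unity // => Dab'.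
have [a0 b0] := conj (root_of_unity_neq0 a1) (root_of_unity_neq0 b1).
have [c0 d0] := conj (root_of_unity_neq0 c1) (root_of_unity_neq0 d1).
have ab : a * b = c * d.
  have e1 : (a + b) / (a * b) = (a + b) / (c * d).
    transitivity (a^-1 + b^-1); first by field; rewrite a0 b0.
    by rewrite Dab' Dab; field; rewrite c0 d0.
  by move/(mulfI ab0)/invr_inj: e1.
have /eqP : (a - c) * (a - d) = 0.
  by transitivity (a ^+ 2 - a * (c + d) + c * d); [ring | rewrite -Dab -ab; ring].
rewrite mulf_eq0 !subr_eq0 => /orP[]/eqP Da; [left | right]; split=> //.
  by move: Dab; rewrite Da => /addrI.
by move: Dab; rewrite Da addrC => /addIr.
Qed.

Lemma has_weightD a b j k : has_weight a j -> has_weight b k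
  -> has_weight (a + b) (j + k).
Proof.
move=> [f f1 ->] [g g1 ->].
exists (fun i => match split i with inl i => f i | inr i => g i end).
  by move=> i; case: (split i).
rewrite big_split_ord /=; congr (_ + _); apply: eq_bigr => i _.
  by rewrite -[lshift k i]/(unsplit (inl i)) unsplitK.
by rewrite -[rshift j i]/(unsplit (inr i)) unsplitK.
Qed.

Lemma shortest_sub_sums (I : finType) (e d : I -> algC) (A B : {set I}) :
    shortest e -> (forall i, root_of_unity (d i)) -> 
    \sum_(i in A) e i = \sum_(i in B) d i ->
  (#|A| <= #|B|)%N.
Proof.
move=> [e_unit e_min] d_unit DAB.
have := has_weightD (has_weight_sum B d_unit) (has_weight_sum (~: A) e_unit).
rewrite -DAB; have -> : \sum_(i in A) e i + \sum_(i in ~: A) e i = \sum_i e i.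
  rewrite [RHS](bigID (mem A)) /=; congr (_ + _).
  by apply: eq_bigl => i; rewrite inE.
by move=> /e_min; rewrite -(cardsC A) leq_add2r.
Qed.


Lemma ord3_mem (s : seq 'I_3) : uniq s -> size s = 3%N -> forall x, x \in s.
Proof.
move=> s_uniq s_size x.
have [||_ ->] := @uniq_min_size _ s (enum 'I_3) s_uniq; last by rewrite mem_enum.
  by move=> y _; rewrite mem_enum.
by rewrite size_enum_ord s_size.
Qed.

Lemma ord3_others (i : 'I_3) : exists k l, uniq [:: i; k; l].
Proof.
by case: i => [[|[|[]]]] // lt_i;
  exists (@Ordinal 3 ((Ordinal lt_i).+1 %% 3) isT), (@Ordinal 3 ((Ordinal lt_i).+2 %% 3) isT).
Qed.

Lemma big_ord3 (i k l : 'I_3) (F : 'I_3 -> algC) :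
  uniq [:: i; k; l] -> \sum_x F x = F i + (F k + F l).
Proof.
move=> ikl; transitivity (\sum_(x <- [:: i; k; l]) F x).
  by rewrite [RHS]big_uniq //; apply: eq_bigl => x; rewrite (ord3_mem ikl).
by rewrite !big_cons big_nil addr0.
Qed.

Lemma ord3_perm (i k l j k' l' : 'I_3) :
    uniq [:: i; k; l] -> uniq [:: j; k'; l'] ->
  exists s : 'S_3, [/\ s j = i, s k' = k & s l' = l].
Proof.
move=> ikl jkl.
pose f x := nth i [:: i; k; l] (index x [:: j; k'; l']).
have inj_f : injective f.
  move=> x y /eqP; rewrite nth_uniq ?index_mem ?(ord3_mem jkl) //.
  by move/eqP/(congr1 (nth j [:: j; k'; l'])); rewrite !nth_index ?(ord3_mem jkl).
exists (perm inj_f); rewrite !permE /f /=.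
move: jkl; rewrite /= !inE negb_or eqxx -andbA => /and4P[/negPf-> /negPf-> /negPf-> _].
by rewrite !eqxx.
Qed.

Lemma two_shortest_sums (e d : 'I_3 -> algC) :
    shortest e -> (forall i, root_of_unity (d i)) -> \sum_i e i = \sum_i d i ->
    (forall (s : 'S_3), exists i, d i != e (s i)) ->
  forall i j, e i != d j.
Proof.
move=> [e_unit e_min] d_unit Ded no_perm i j; apply/eqP=> Dij.
have [k [l ikl]] := ord3_others i; have [k' [l' jkl]] := ord3_others j.
have [s [sj sk sl]] := ord3_perm ikl jkl.
have ilk : uniq [:: i; l; k].
  by move: ikl; rewrite /= !inE !negb_or -!andbA => /and4P[-> -> ]; rewrite eq_sym => ->.
have [s' [sj' sk' sl']] := ord3_perm ilk jkl.
have all_d (r : 'S_3) : d j = e (r j) -> d k' = e (r k') -> d l' = e (r l') -> False.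
  move=> rj rk rl; have [x /eqP[]] := no_perm r.
  by have := ord3_mem jkl (erefl _) x; rewrite !inE => /or3P[]/eqP->.
rewrite (big_ord3 _ ikl) (big_ord3 _ jkl) Dij in Ded; move/addrI in Ded.
have [|[e1 e2]|[e1 e2]] := addr_root_of_unity_inj (e_unit k) (e_unit l) (d_unit k') (d_unit l') Ded.
- apply/eqP=> e0; have := e_min 1%N; rewrite (big_ord3 _ ikl) e0 addr0 card_ord => H.
  by have /H : has_weight (e i) 1; [exists (fun=> e i); rewrite ?big_ord1|].
- by apply: (all_d s); rewrite ?sj ?sk ?sl.
- by apply: (all_d s'); rewrite ?sj' ?sk' ?sl'.
Qed.

(** A vanishing subsum equates a part [B] of [e] with a part [C] of [d], of the same size as both
    sums are shortest. Size one is excluded by hypothesis, size two by passing to complements. *)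
Lemma shortest_minimal_vanishing (e d : 'I_3 -> algC) :
    shortest e -> shortest d -> \sum_i e i = \sum_i d i ->
    (forall i j, e i != d j) ->
  minimal_vanishing (fun x : 'I_3 + 'I_3 => match x with inl i => e i | inr j => - d j end).
Proof.
move=> e_short d_short Ded ed.
have [e_unit _] := e_short; have [d_unit _] := d_short.
split=> [|A A_neq0]; first by rewrite big_sumType /= Ded sumrN subrr.
pose B := [set i | inl i \in A]; pose C := [set j | inr j \in A].
rewrite big_sumType /= sumrN => /eqP; rewrite subr_eq0 => /eqP sumA.
have sumBC : \sum_(i in B) e i = \sum_(j in C) d j.
  by rewrite (eq_bigl _ _ (in_set _)) sumA; apply: eq_bigl => j; rewrite inE.
have sumBCc : \sum_(i in ~: B) e i = \sum_(j in ~: C) d j.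
  apply: (addrI (\sum_(i in B) e i)); rewrite {2}sumBC.
  have compl (F : 'I_3 -> algC) (D : {set 'I_3}) :
      \sum_(i in D) F i + \sum_(i in ~: D) F i = \sum_i F i.
    rewrite [RHS](bigID (mem D)) /=; congr (_ + _).
    by apply: eq_bigl => i; rewrite inE.
  by rewrite !compl.
have cardBC : #|B| = #|C|.
  apply/eqP; rewrite eqn_leq (shortest_sub_sums e_short d_unit sumBC).
  exact: (shortest_sub_sums d_short e_unit (esym sumBC)).
have no_single (D E : {set 'I_3}) : #|D| = 1%N -> #|E| = 1%N ->
    \sum_(i in D) e i = \sum_(j in E) d j -> False.
  move=> /eqP/cards1P[i ->] /eqP/cards1P[j ->]; rewrite !big_set1 => /eqP.
  by rewrite (negPf (ed i j)).
have : (#|B| <= 3)%N by rewrite -[X in (_ <= X)%N](card_ord 3) max_card.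
case B3: #|B| => [|[|[|[|//]]]] _.
- case/set0Pn: A_neq0 => -[i|j] A_x.
    by have := card0_eq B3 i; rewrite !inE A_x.
  by have := card0_eq (etrans (esym cardBC) B3) j; rewrite !inE A_x.
- by case: (no_single B C); rewrite -?cardBC.
- by case: (no_single (~: B) (~: C)) => //; rewrite cardsCs setCK -?cardBC card_ord B3.
have full (D : {set 'I_3}) : #|D| = 3%N -> D = setT.
  by move=> D3; apply/eqP; rewrite eqEcard subsetT D3 cardsT card_ord.
apply/setP=> -[i|j]; rewrite inE.
  by have /setP/(_ i) := full _ B3; rewrite !inE.
by have /setP/(_ j) := full _ (etrans (esym cardBC) B3); rewrite !inE.
Qed.

Lemma uniq3 (T : eqType) (x y z : T) : uniq [:: x; y; z] = [&& x != y, x != z & y != z].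
Proof. by rewrite /= !inE negb_or andbT -andbA. Qed.

Lemma ord3_third (i k : 'I_3) : i != k -> exists l, uniq [:: i; k; l].
Proof.
move=> ik; have [x [y ixy]] := ord3_others i; move: (ixy);
  rewrite uniq3 => /and3P[ix iy xy].
have := ord3_mem ixy (erefl _) k; rewrite !inE eq_sym (negPf ik) orFb => /orP[]/eqP->.
  by exists y; rewrite uniq3 ix iy.
by exists x; rewrite uniq3 ix iy eq_sym.
Qed.

Lemma shortest_no_pair (e : 'I_3 -> algC) i j rho :
  shortest e -> i != j -> root_of_unity rho -> e i + e j <> rho.
Proof.
move=> [e_unit e_min] ij rho_unit Drho.
have [k [l ikl]] := ord3_others i.
pose y x := if x == i then rho else e x.
suff /e_min : has_weight (\sum_x e x) 2 by rewrite card_ord.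
have Dsum : \sum_x e x = \sum_(x in ~: [set j]) y x.
  rewrite (bigD1 j) //= (bigD1 i) //= addrA [e j + _]addrC Drho.
  rewrite [RHS](bigD1 i) ?inE //= /y eqxx; congr (_ + _); apply: eq_big => x.
    by rewrite !inE.
  by case/andP=> _ /negPf->.
have y_unit x : root_of_unity (y x) by rewrite /y; case: ifP.
by have := has_weight_sum (~: [set j]) y_unit;
  rewrite -Dsum cardsCs setCK cards1 card_ord.
Qed.

(* If w is the primitive cube root of unity with a = - rho w, the first two
   clauses say that u a = rho w^2; the last two, that b, c, - u b, - u c are the
   rho z^k, 0 < k < 5, for a primitive fifth root of unity z. *)
Definition skew (u : algC -> algC) (a b c rho : algC) :=
  [/\ u a = a - rho, a * (a - rho) = - rho ^+ 2, uniq [:: rho; b; c; - u b; - u c]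
    & all (fun y => y ^+ 5 == rho ^+ 5) [:: rho; b; c; - u b; - u c]].

(** The two terms adding up to [rho] come one from [e] and one from - [d]: merging two terms of the
    same side would shorten its sum. *)
Lemma shortest_skew_pair (e d : 'I_3 -> algC) :
    shortest e -> shortest d -> \sum_i e i = \sum_i d i ->
    (forall s : 'S_3, exists i, d i != e (s i)) ->
  exists rho i j,
    [/\ root_of_unity rho, e i - d j = rho, e i * - d j = rho ^+ 2
      & forall k l k' l', uniq [:: i; k; l] -> uniq [:: j; k'; l'] ->
        uniq [:: rho; e k; e l; - d k'; - d l'] /\
        all (fun y => y ^+ 5 == rho ^+ 5) [:: rho; e k; e l; - d k'; - d l']].
Proof.
move=> e_short d_short Ded no_perm.
have [e_unit _] := e_short; have [d_unit _] := d_short.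
have ed := two_shortest_sums e_short d_unit Ded no_perm.
pose x (z : 'I_3 + 'I_3) := match z with inl i => e i | inr j => - d j end.
have card_I : #|{: 'I_3 + 'I_3}| = 6%N by rewrite card_sum !card_ord.
have x_unit z : root_of_unity (x z) by case: z => // j; apply: root_of_unityN.
have [rho [z1 [z2 [z12 rho_unit Drho rho5 x_inj]]]] :=
  six_term_vanishing card_I x_unit (shortest_minimal_vanishing e_short d_short Ded ed).
have Nd_unit j : root_of_unity (- d j) by apply: root_of_unityN.
have main i j : e i - d j = rho ->
    (forall z, z != inl i -> z != inr j -> x z ^+ 5 = rho ^+ 5 /\ x z != rho) ->
    (forall z z', z != inl i -> z != inr j -> z' != inl i -> z' != inr j -> x z = x z' -> z = z') ->
  exists rho i j,
    [/\ root_of_unity rho, e i - d j = rho, e i * - d j = rho ^+ 2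
      & forall k l k' l', uniq [:: i; k; l] -> uniq [:: j; k'; l'] ->
        uniq [:: rho; e k; e l; - d k'; - d l'] /\
        all (fun y => y ^+ 5 == rho ^+ 5) [:: rho; e k; e l; - d k'; - d l']].
  move=> Dij {}rho5 {}x_inj; exists rho, i, j; split=> //;
    first exact: addr_root_of_unity_mul.
  move=> k l k' l'; rewrite !uniq3 => /and3P[ik il kl] /and3P[jk jl kl'].
  have others : {in [:: inl k; inl l; inr k'; inr l'], forall z, z != inl i /\ z != inr j}.
    move=> z; rewrite !inE => /or4P[]/eqP->; split=> //; apply/eqP=> -[Dz].
    - by rewrite Dz eqxx in ik.
    - by rewrite Dz eqxx in il.
    - by rewrite Dz eqxx in jk.
    - by rewrite Dz eqxx in jl.
  pose s := [:: inl k; inl l; inr k'; inr l'] : seq ('I_3 + 'I_3).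
  suff: uniq (rho :: map x s) /\ all (fun y => y ^+ 5 == rho ^+ 5) (rho :: map x s) by [].
  split.
    rewrite cons_uniq map_inj_in_uniq => [|z z' /others[? ?] /others[? ?]];
      last exact: x_inj.
    apply/andP; split; last by rewrite /= !inE !orbF (inj_eq inl_inj) (inj_eq inr_inj) kl kl'.
    by apply/mapP=> -[z /others[zi zj] Dz]; case: (rho5 z zi zj); rewrite -Dz eqxx.
  rewrite [all _ _]/(_ && all _ (map x s)) eqxx;
    apply/allP=> _ /mapP[z /others[zi zj] ->].
  by case: (rho5 z zi zj) => ->.
case: z1 z2 z12 Drho rho5 x_inj => [i|j] [i'|j'] /= z12 Drho rho5 x_inj.
- by case: (shortest_no_pair e_short _ rho_unit Drho).
- exact: (main i j').
- apply: (main i' j); first by rewrite addrC.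
    by move=> z ? ?; apply: rho5.
  by move=> z z' ? ? ? ?; apply: x_inj.
- case: (@shortest_no_pair d j j' (- rho)) => //; first exact: root_of_unityN.
  by rewrite -Drho opprD !opprK.
Qed.

Lemma skew_pow6 (a rho : algC) : a * (a - rho) = - rho ^+ 2 -> a ^+ 6 = rho ^+ 6.
Proof.
move=> Da; have a3 : a ^+ 3 = - rho ^+ 3.
  transitivity (a * (a * (a - rho)) + rho * (a * (a - rho)) + rho ^+ 2 * a);
    first by ring.
  by rewrite Da; ring.
by rewrite (exprM a 3 2) a3 sqrrN -exprM.
Qed.

(** Since a / rho is a root of X^2 - X + 1, the sixth powers agree; equal fifth powers would then
    force a = rho. This inequality is what singles out one summand of the three. *)
Lemma skew_pow5 (a rho : algC) :
  rho != 0 -> a * (a - rho) = - rho ^+ 2 -> a ^+ 5 <> rho ^+ 5.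
Proof.
move=> rho0 Da a5; have := skew_pow6 Da; rewrite exprS a5 => /mulIf.
rewrite expf_neq0 // => /(_ isT) Da'.
by move/eqP: Da; rewrite Da' subrr mulr0 eq_sym oppr_eq0 expf_eq0 (negPf rho0) andbF.
Qed.

(** Once some [e i] is paired with some - [u (e j)], it remains to see that i = j. Otherwise, for
    the third index [z], both - [u (e i)] and - [u (e z)] are fifth roots of [rho ^+ 5], so [e i]
    and [e z] have the same fifth power, namely [rho ^+ 5]. *)
Lemma shortest_skew (e : 'I_3 -> algC) (u : {rmorphism algC -> algC}) :
    shortest e -> u (\sum_i e i) = \sum_i e i ->
    (forall s : 'S_3, exists i, u (e i) != e (s i)) ->
  exists rho i, root_of_unity rho /\
    forall k l, uniq [:: i; k; l] -> skew u (e i) (e k) (e l) rho.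
Proof.
move=> e_short fix_e no_perm; rewrite rmorph_sum in fix_e.
have [e_unit e_min] := e_short.
have ue_short : shortest (fun i => u (e i)).
  by split=> [i|]; [apply: root_of_unity_aut | rewrite fix_e].
have [rho [i [j [rho_unit Drho mul_rho skew_ij]]]] :=
  shortest_skew_pair e_short ue_short (esym fix_e) no_perm.
have rho0 := root_of_unity_neq0 rho_unit.
have Dui : u (e j) = e i - rho by rewrite -Drho opprB addrC subrK.
have Dei : e i * (e i - rho) = - rho ^+ 2 by rewrite -Dui -mul_rho mulrN opprK.
have Duj : - u (e j) * (- u (e j) - rho) = - rho ^+ 2.
  by rewrite Dui -Dei; ring.
exists rho, i; split=> //; suff ij : i = j.
  move=> k l ikl; have [] := skew_ij k l k l ikl; rewrite -?ij // => ? ?.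
  by split; rewrite // ij Dui -ij.
apply/eqP/negPn/negP => ij.
have [z] := ord3_third ij; rewrite uniq3 => /and3P[_ iz jz].
have [l izl] := ord3_third iz; have ji : j != i by rewrite eq_sym.
have [l' jil] := ord3_third ji; have [l'' jzl] := ord3_third jz.
have [_ /and5P[_ /eqP ez _ /eqP ui _]] := skew_ij _ _ _ _ izl jil.
have [_ /and5P[_ _ _ /eqP uz _]] := skew_ij _ _ _ _ izl jzl.
have /fmorph_inj : u (e i ^+ 5) = u (e z ^+ 5).
  have oddX (y : algC) : - y ^+ 5 = (- y) ^+ 5 by ring.
  by apply: oppr_inj; rewrite !rmorphXn !oddX ui uz.
by rewrite ez //; apply: skew_pow5.
Qed.

(** * Images of the summands under the automorphisms fixing the sum *)

Lemma aut_permP (e : 'I_3 -> algC) (u : algC -> algC) :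
  (exists s : 'S_3, forall i, u (e i) = e (s i)) \/
  (forall s : 'S_3, exists i, u (e i) != e (s i)).
Proof.
have [/existsP[s /forallP us]|/existsPn no_s] :=
  boolP [exists s : 'S_3, [forall i, u (e i) == e (s i)]].
  by left; exists s => i; apply/eqP.
by right=> s; apply/existsP; rewrite -negb_forall.
Qed.

Lemma mem_fifth_powers (s : seq algC) (rho y : algC) :
    rho != 0 -> uniq s -> size s = 5%N -> all (fun y => y ^+ 5 == rho ^+ 5) s ->
  y ^+ 5 = rho ^+ 5 -> y \in s.
Proof.
move=> rho0 s_uniq s_size s5 y5; apply/negPn/negP => ys.
have p0 : 'X^5 - (rho ^+ 5)%:P != 0 :> {poly algC} by rewrite -size_poly_eq0 size_XnsubC.
have := max_poly_roots p0 (rs := y :: s); rewrite size_XnsubC //= s_size ltnn ys s_uniq.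
rewrite rootE !hornerE y5 subrr eqxx /= => H; apply: notF; apply: H => //.
by apply: sub_all s5 => z /eqP z5; rewrite rootE !hornerE z5 subrr.
Qed.

Section SkewOrbit.

Variables (e : 'I_3 -> algC) (t : {rmorphism algC -> algC}) (rho : algC) (i k l : 'I_3).
Hypotheses (e_short : shortest e) (ikl : uniq [:: i; k; l]) (rho_unit : root_of_unity rho).
Hypothesis skew_t : skew t (e i) (e k) (e l) rho.

(** If [u] permutes the summands, it fixes [e i], the only one whose fifth power is not [rho ^+ 5].
    If not, it is skew for the same [i], by fifth powers, and the same [rho], by fifth and sixth
    powers; then - [u (e k)] is a fifth root of [rho ^+ 5] other than [rho], [e k], [e l], and only
    - [t (e k)] and - [t (e l)] are left. *)
Lemma skew_orbit (u : {rmorphism algC -> algC}) :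
    u (\sum_x e x) = \sum_x e x ->
  (u (e i), u (e k)) \in
    [:: (e i, e k); (e i, e l); (t (e i), t (e k)); (t (e i), t (e l))].
Proof.
move=> fix_u; have [Dti Dei uniq_t t5] := skew_t.
have rho0 := root_of_unity_neq0 rho_unit.
have e5 x : x != i -> e x ^+ 5 = rho ^+ 5.
  move=> xi; have := ord3_mem ikl (erefl _) x; rewrite !inE (negPf xi) orFb.
  by case/and5P: t5 => _ /eqP ek /eqP el _ _ /orP[]/eqP->.
have ei5 := skew_pow5 rho0 Dei.
have [[s us] | no_perm] := aut_permP e u.
  have si : s i = i.
    apply/eqP/negPn/negP => si.
    have [x xi sx] : exists2 x, x != i & s x = i.
      exists (s^-1%g i); rewrite ?permKV //.
      by apply: contraNneq si => Di; rewrite -{1}Di permKV.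
    have [y] : exists y, uniq [:: i; x; y] by apply: ord3_third; rewrite eq_sym.
    rewrite uniq3 => /and3P[ix iy xy].
    have sy : s y != i by rewrite -sx (inj_eq perm_inj) eq_sym.
    apply: ei5; rewrite -sx -us -(e5 (s y)) // -us -!rmorphXn; congr (u _).
    by rewrite !e5 // eq_sym.
  have sk : s k != i.
    by rewrite -[X in _ != X]si (inj_eq perm_inj); move: ikl;
      rewrite uniq3 eq_sym => /andP[].
  rewrite !us si; have := ord3_mem ikl (erefl _) (s k).
  by rewrite !inE (negPf sk) orFb => /orP[]/eqP->; rewrite eqxx ?orbT.
have [rho' [i' [rho1' skew_u]]] := shortest_skew e_short fix_u no_perm.
have i'i : i' = i.
  apply/eqP/negPn/negP => i'i.
  have [y] := ord3_third i'i; move=> ii'y; move: (ii'y); rewrite uniq3 => /and3P[_ _ iy].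
  have [_ _ _ /and5P[_ /eqP e1 /eqP e2 _ _]] := skew_u _ _ ii'y.
  by apply: ei5; rewrite e1 -e2 e5 // eq_sym.
rewrite {i'}i'i in skew_u *.
have [Dui Dei' uniq_u u5] := skew_u _ _ ikl.
have rho5 : rho' ^+ 5 = rho ^+ 5.
  by case/and5P: u5 => _ /eqP <- _ _ _; rewrite e5 //; move: ikl;
    rewrite uniq3 eq_sym => /andP[].
have Drho : rho' = rho.
  have := skew_pow6 Dei'; rewrite (skew_pow6 Dei) !(exprS _ 5) rho5 => /mulIf.
  by rewrite expf_neq0 // => /(_ isT)->.
rewrite {}Drho {rho5 skew_u rho1' Dei'} in Dui uniq_u u5.
have mem_roots y : y ^+ 5 = rho ^+ 5 -> y \in [:: rho; e k; e l; - t (e k); - t (e l)].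
  exact: mem_fifth_powers.
have : - u (e k) \in [:: rho; e k; e l; - t (e k); - t (e l)].
  by apply: mem_roots; case/and5P: u5 => _ _ _ /eqP.
have : - u (e k) \notin [:: - u (e l); rho; e k; e l].
  by move: uniq_u; rewrite -(rot_uniq 3) => /andP[].
rewrite !inE !negb_or => /and4P[_ /negPf-> /negPf-> /negPf->] /=.
by rewrite Dui -Dti !(inj_eq oppr_inj) => /orP[]/eqP->; rewrite eqxx ?orbT.
Qed.

Lemma aut_eq_on_two (u v : {rmorphism algC -> algC}) :
    u (\sum_x e x) = \sum_x e x -> v (\sum_x e x) = \sum_x e x ->
    (u (e i), u (e k)) = (v (e i), v (e k)) ->
  forall x, u (e x) = v (e x).
Proof.
move=> fix_u fix_v [ui uk] x.
have ul : u (e l) = v (e l).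
  have := etrans fix_u (esym fix_v); rewrite (big_ord3 _ ikl) !rmorphD /= ui uk.
  by move=> /addrI/addrI.
by have := ord3_mem ikl (erefl _) x; rewrite !inE => /or3P[]/eqP->.
Qed.

End SkewOrbit.

(** * Bounding the Galois group *)

(** The generated subgroup is abelian while ['S_3] is not, so its order is a proper divisor of 6. *)
Lemma commuting_perms3 (P : {set 'S_3}) :
  {in P &, forall s s' : 'S_3, commute s s'} -> (#|P| <= 3)%N.
Proof.
move=> commP; have abP : abelian <<P>>.
  by rewrite abelian_gen; apply/centsP=> s Ps s' Ps'; apply: commP.
apply: (leq_trans (subset_leq_card (subset_gen P))).
have : (#|<<P>>%g| %| 6)%N.
  have <- : #|[set: 'S_3]| = 6%N by rewrite cardsT card_Sn.
  exact/cardSg/subsetT.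
rewrite dvdn_divisors // -[divisors 6]/[:: 1; 2; 3; 6]%N !inE => /or4P[]/eqP cP;
  rewrite ?cP //.
have /eqP PT : <<P>>%g == [set: 'S_3].
  by rewrite eqEcard subsetT cP cardsT card_Sn.
rewrite PT in abP; pose i1 := @Ordinal 3 1 isT.
have /centsP/(_ (tperm ord0 i1) (in_setT _)) := abP.
move=> /(_ (tperm ord0 ord_max) (in_setT _)) /permP/(_ ord0).
by rewrite !permM !tpermL tpermD // tpermD.
Qed.

Lemma min_common_orderP (I : finType) (x : I -> algC) :
    (forall i, root_of_unity (x i)) ->
  exists2 m, (0 < m)%N & forall j, (forall i, x i ^+ j = 1) <-> (m %| j)%N.
Proof.
move=> x_unit; have [m [m_gt0 xm] m_min] := min_common_order (isT : (0 < 1)%N) x_unit.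
rewrite muln1 in xm m_min; exists m => // j; split=> [xj | /dvdnP[q ->] i]; last first.
  by rewrite mulnC exprM xm expr1n.
have xg i : x i ^+ gcdn m j = 1.
  have /prim_order_exists[|d prim_d _] := xm i; first by [].
  by apply/eqP; rewrite -(prim_order_dvd prim_d) dvdn_gcd !(prim_order_dvd prim_d) xm xj !eqxx.
suff <- : gcdn m j = m by apply: dvdn_gcdr.
apply/eqP; rewrite eqn_leq dvdn_leq ?dvdn_gcdl //= leqNgt; apply/negP=> g_lt.
have g_gt0 : (0 < gcdn m j)%N by rewrite gcdn_gt0 m_gt0.
have [|p p_pr p_q] := @pdivP (m %/ gcdn m j).
  by rewrite ltn_divRL ?dvdn_gcdl // mul1n.
have Dm := divnK (dvdn_gcdl m j).
have p_m : (p %| m)%N by rewrite -Dm dvdn_mulr.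
have [i /eqP[]] := m_min p p_pr p_m.
by rewrite -{1}Dm -divn_mulAC // mulnC exprM xg expr1n.
Qed.

Lemma Q_sub_summands (I : finType) (x : I -> algC) m :
  (0 < m)%N -> (forall i, x i ^+ m = 1) -> Q_sub (\sum_i x i) (prim_root m).
Proof.
move=> m_gt0 xm; have prim_z := prim_rootE m_gt0.
have Dx i : {k : 'I_m | x i = prim_root m ^+ k} by apply: prim_rootP.
apply/Q_subP; exists (\sum_i 'X^(sval (Dx i))).
rewrite rmorph_sum horner_sum; apply: eq_bigr => i _.
by rewrite /= map_polyXn hornerXn; case: (Dx i).
Qed.

Lemma conductor_fixed alpha n (u : {rmorphism algC -> algC}) :
  is_conductor alpha n -> (forall z, z ^+ n = 1 -> u z = z) -> u alpha = alpha.
Proof.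
move=> [n_gt0 /Q_subP[p ->] _] fix_u.
by rewrite aut_horner_rat fix_u // (prim_expr_order (prim_rootE n_gt0)).
Qed.

(* Minimality of the conductor makes the least common order D of the summands
   n or 2 * n, so that the summands generate all the n-th roots of unity. *)
Lemma conductor_aut_inj (I : finType) (e : I -> algC) n (u v : {rmorphism algC -> algC}) :
    shortest e -> is_conductor (\sum_i e i) n ->
    (forall i, u (e i) = v (e i)) ->
  forall z, z ^+ n = 1 -> u z = v z.
Proof.
move=> e_short cond uv z zn; have [n_gt0 _ n_min] := cond.
have [e_unit _] := e_short.
have [D D_gt0 DP] := min_common_orderP e_unit.
have eD : forall i, e i ^+ D = 1 by apply/DP.
have n_le_D := n_min D D_gt0 (Q_sub_summands D_gt0 eD).
have D_2n : (D %| 2 * n)%N.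
  apply: (@dvdn_trans (lcmn 2 n)); last by rewrite dvdn_lcm dvdn_mulr ?dvdn_mull.
  apply/DP; apply: (shortest_in_field n_gt0 e_short) => w fix_w.
  exact: conductor_fixed cond fix_w.
have n_D : (n %| D)%N.
  case/dvdnP: D_2n => q Dq; case: q Dq => [|[|[|q]]] Dq.
  - by move/eqP: Dq; rewrite mul0n muln_eq0 /= eqn0Ngt n_gt0.
  - by rewrite -[D]mul1n -Dq dvdn_mull.
  - by move/eqP: Dq; rewrite eqn_mul2l /= => /eqP->.
  have : (q.+3 * D <= 2 * D)%N by rewrite -Dq leq_mul2l n_le_D.
  by rewrite leq_pmul2r.
have [y prim_y] := C_prim_root_exists D_gt0.
have [a Da] := aut_unity_rootP u D_gt0 (prim_expr_order prim_y).
have [b Db] := aut_unity_rootP v D_gt0 (prim_expr_order prim_y).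
have De i : {c : 'I_D | e i = y ^+ c} by apply: prim_rootP.
(* [u] and [v] act as the exponents [a] and [b]; since these agree on every [e i], they agree modulo
   the least common order [D]. *)
have eab i : e i ^+ a = e i ^+ b.
  have := uv i; case: (De i) => c ->; rewrite !rmorphXn Da Db /= => yab.
  by rewrite exprAC yab exprAC.
have ab : a = b %[mod D].
  wlog ba : a b {Da Db} eab / (b <= a)%N.
    move=> IH; case: (leqP b a) => [|/ltnW] ba; first exact: IH.
    by apply/esym/IH => // i; rewrite eab.
  apply/eqP; rewrite eqn_mod_dvd //; apply/DP => i.
  apply: (mulfI (_ : e i ^+ b != 0)); first by rewrite expf_neq0 ?root_of_unity_neq0.
  by rewrite -exprD subnKC // mulr1.
have uvy : u y = v y by apply/eqP; rewrite Da Db (eq_prim_root_expr prim_y) ab.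
have [|c ->] := prim_rootP prim_y (_ : z ^+ D = 1); last by rewrite !rmorphXn uvy.
by case/dvdnP: n_D => q ->; rewrite mulnC exprM zn expr1n.
Qed.

(** When a value is repeated, [s] is not determined by [u]; but a permutation of the terms preserves
    multiplicities, so every value is fixed. *)
Lemma perm_repeated (e : 'I_3 -> algC) (u : algC -> algC) (s : 'S_3) (x y : 'I_3) :
  x != y -> e x = e y -> (forall i, u (e i) = e (s i)) -> forall i, u (e i) = e i.
Proof.
move=> xy exy us; have [z xyz] := ord3_third xy.
have mem3 w : [\/ w = x, w = y | w = z].
  by have := ord3_mem xyz (erefl _) w; rewrite !inE => /or3P[]/eqP;
    [constructor 1|constructor 2|constructor 3].
have e_or w : w != z -> e w = e x.
  by case: (mem3 w) => -> //; rewrite eqxx.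
have [ezx | ezx] := eqVneq (e z) (e x).
  have all_e w : e w = e x by case: (mem3 w) => ->.
  by move=> w; rewrite us !all_e.
have usz : u (e x) = e x.
  have [sx | sx] := eqVneq (s x) z; last by rewrite us e_or.
  have [sy | sy] := eqVneq (s y) z.
    by have /perm_inj/eqP := etrans sx (esym sy); rewrite (negPf xy).
  by rewrite exy us e_or.
move=> w; have [-> | wz] := eqVneq w z; last by rewrite e_or.
suff sz : s z = z by rewrite us sz.
apply/eqP/negPn/negP => sz; have := permKV s z; set v := (s^-1)%g z => sv.
have vz : v != z by apply: contraNneq sz => vz; rewrite -{1}vz sv.
by move: ezx; rewrite -sv -us (e_or v vz) usz eqxx.
Qed.

Section Family.

Variables (K : finType) (H : {set K}) (u : K -> {rmorphism algC -> algC}).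
Variable e : 'I_3 -> algC.
Hypotheses (e_short : shortest e).
Hypothesis fix_H : forall k, k \in H -> u k (\sum_i e i) = \sum_i e i.
Hypothesis inj_H : {in H &, forall k l, (forall i, u k (e i) = u l (e i)) -> k = l}.

(** If [e] is injective, distinct members of [H] give distinct permutations, and these commute
    because automorphisms act on roots of unity as power maps. With a repeated value every [u k]
    fixes all the [e i], and [H] has at most one element. *)
Lemma perm_family_bound :
  (forall k, k \in H -> exists s : 'S_3, forall i, u k (e i) = e (s i)) -> (#|H| <= 3)%N.
Proof.
move=> permH; have [e_unit _] := e_short.
have [/injectiveP e_inj | /injectivePn[x [y xy exy]]] := boolP (injectiveb e); last first.
  have fixE k : k \in H -> forall i, u k (e i) = e i.
    by move=> /permH[s]; apply: perm_repeated xy exy.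
  rewrite (@leq_trans 1) //; apply/card_le1P => k Hk l; rewrite inE.
  apply/idP/eqP => [Hl|-> //]; apply: inj_H => // i.
  by rewrite !fixE.
have [f Df] : exists f : K -> 'S_3, forall k, k \in H -> forall i, u k (e i) = e (f k i).
  have [k|f Df] := @fin_all_exists _ _ (fun k (s : 'S_3) => k \in H -> forall i, u k (e i) = e (s i)).
    by have [/permH[s us]|] := boolP (k \in H); [exists s | exists 1%g].
  by exists f.
have <- : #|f @: H| = #|H|.
  by apply: card_in_imset => k l Hk Hl Dfkl; apply: inj_H => // i; rewrite !Df // Dfkl.
apply: commuting_perms3 => _ _ /imsetP[k Hk ->] /imsetP[l Hl ->].
apply/permP=> i; rewrite !permM; apply: e_inj.
rewrite -(Df l) // -(Df k) // -(Df k) // -(Df l) //.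
have /root_of_unityP[m m_gt0 em] := e_unit i.
exact: aut_unity_rootC em.
Qed.

(** The pairs (u h (e i), u h (e k)) are distinct members of a list of four; four of them exhaust
    it, so (e i, e l) is attained. *)
Lemma skew_family_bound (t : {rmorphism algC -> algC}) rho (i k l : 'I_3) :
    uniq [:: i; k; l] -> root_of_unity rho -> skew t (e i) (e k) (e l) rho ->
  (#|H| <= 4)%N /\
  (#|H| = 4%N -> exists2 h, h \in H & u h (e i) = e i /\ u h (e k) = e l).
Proof.
move=> ikl rho_unit skew_t.
set Q := [:: (e i, e k); (e i, e l); (t (e i), t (e k)); (t (e i), t (e l))].
pose g h := (u h (e i), u h (e k)); pose s := [seq g h | h in H].
have s_size : size s = #|H| by rewrite size_map cardE.
have s_uniq : uniq s.
  rewrite map_inj_in_uniq ?enum_uniq // => h h'; rewrite !mem_enum => Hh Hh' Dg.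
  by apply: inj_H => //; apply: (aut_eq_on_two ikl) Dg; apply: fix_H.
have sQ : {subset s <= Q}.
  move=> q /mapP[h]; rewrite mem_enum => Hh ->{q}.
  by apply: (skew_orbit e_short ikl rho_unit skew_t); apply: fix_H.
rewrite -s_size; split; first exact: (uniq_leq_size s_uniq sQ).
move=> s4; have [|_ DQ] := uniq_min_size s_uniq sQ; first by rewrite s4.
have : (e i, e l) \in s by rewrite DQ !inE eqxx orbT.
by case/mapP=> h; rewrite mem_enum => Hh [ei el]; exists h.
Qed.

End Family.

(** * The case of degree four *)

Lemma prime_primitive_root p (z : algC) :
  prime p -> z ^+ p = 1 -> z != 1 -> p.-primitive_root z.
Proof.
move=> p_pr zp z1; have [m prim_z m_p] := prim_order_exists (prime_gt0 p_pr) zp.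
have /primeP[_ /(_ m m_p) /orP[]/eqP Dm] := p_pr; last by rewrite -Dm.
by move: prim_z z1; rewrite Dm => /prim_expr_order; rewrite expr1 => ->; rewrite eqxx.
Qed.

Lemma primitive_root6 (z : algC) : z ^+ 3 = -1 -> z ^+ 2 != 1 -> 6.-primitive_root z.
Proof.
move=> z3 z2; have z6 : z ^+ 6 = 1 by rewrite (exprM z 3 2) z3 sqrrN expr1n.
have N11 : -1 != 1 :> algC by rewrite -subr_eq0 -opprD oppr_eq0 -(natrD _ 1 1) pnatr_eq0.
have [m prim_z] := prim_order_exists (isT : (0 < 6)%N) z6.
rewrite dvdn_divisors // -[divisors 6]/[:: 1; 2; 3; 6]%N !inE => /or4P[]/eqP Dm;
  last by rewrite -Dm.
- by case/eqP: z2; rewrite Dm in prim_z;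
    rewrite -[z]expr1 (prim_expr_order prim_z) expr1n.
- by case/eqP: z2; rewrite Dm in prim_z; rewrite (prim_expr_order prim_z).
- by case/eqP: N11; rewrite Dm in prim_z; rewrite -z3 (prim_expr_order prim_z).
Qed.

Lemma zeta5_prim : 5.-primitive_root (zeta 5).
Proof.
have r5 : 5.-root (-1) ^+ 5 = -1 :> algC by rewrite rootCK.
apply: prime_primitive_root => //; first by rewrite /zeta exprAC r5 sqrrN expr1n.
rewrite /zeta sqrf_eq1; apply/norP; split.
  apply: contra_eqN r5 => /eqP->; rewrite expr1n -subr_eq0 opprK.
  by rewrite -(natrD _ 1 1) pnatr_eq0.
(* A principal root of exponent above 1 is never a negative real. *)
have := @rootC_lt0 algC 5 (-1) isT; apply: contraFN => /eqP->.
by rewrite oppr_lt0 ltr01.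
Qed.

(* (sqrt 3 + i) / 2 is a 6-th root of -1 with positive real part, so the
   principal one cannot be i. *)
Lemma zeta6_prim : 6.-primitive_root (zeta 6).
Proof.
set r := 6.-root (-1) : algC; have r6 : r ^+ 6 = -1 by rewrite /r rootCK.
apply: primitive_root6; rewrite /zeta -/r; first by rewrite -exprM r6.
apply: contraT; rewrite negbK => /eqP r4.
have r2 : r ^+ 2 = -1 by rewrite -r6 (exprD r 4 2) (exprM r 2 2) r4 mul1r.
pose s : algC := sqrtC 3; have s2 : s ^+ 2 = 3 by rewrite sqrtCK.
have s_gt0 : 0 < s by rewrite sqrtC_gt0 ltr0n.
pose y : algC := s / 2 + 'i * (1 / 2).
have s_real : s / 2 \is Num.real by rewrite gtr0_real // divr_gt0.
have half_real : 1 / 2 \is @Num.real algC by rewrite gtr0_real // divr_gt0.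
have y3 : y ^+ 3 = 'i.
  rewrite /y; transitivity ((s * (s ^+ 2 + 3 * 'i ^+ 2) + 'i * (3 * s ^+ 2 + 'i ^+ 2)) / 8); first by field.
  by rewrite s2 sqrCi; field.
have y6 : y ^+ 6 = -1 by rewrite (exprM y 3 2) y3 sqrCi.
have := rootC_Re_max (isT : (0 < 6)%N) y6; rewrite Im_rect // Re_rect // -/r.
have -> : 'Re r = 0.
  have /eqP : (r - 'i) * (r + 'i) = 0 by rewrite -subr_sqr r2 sqrCi subrr.
  rewrite mulf_eq0 subr_eq0 addr_eq0 => /orP[]/eqP->; rewrite ?raddfN /= Re_i ?oppr0 //.
by rewrite divr_ge0 // => /(_ isT); rewrite lt_geF // divr_gt0.
Qed.

Lemma eq_pow56 (x y : algC) : y != 0 -> x ^+ 5 = y ^+ 5 -> x ^+ 6 = y ^+ 6 -> x = y.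
Proof.
by move=> y0 xy5; rewrite !(exprS _ 5) xy5 => /mulIf; rewrite expf_neq0 // => /(_ isT).
Qed.

Lemma skew_form (s t : {rmorphism algC -> algC}) (a b c rho : algC) :
    root_of_unity rho -> skew t a b c rho -> s a = a -> s b = c -> s c = b ->
  exists (k : 'Z_6) (l : 'Z_5) (eps : algC) (m : nat),
    [/\ k \is a GRing.unit, l \is a GRing.unit, m.-primitive_root eps,
        [&& 4 %| m, ~~ (3 %| m) & ~~ (5 %| m)]%N
      & a + (b + c) = eps * (zeta 6 ^+ k + zeta 5 ^+ l + zeta 5 ^+ (4 * l)%N)].
Proof.
move=> rho_unit [ta Da abc_uniq abc5] sa sb sc.
have rho0 := root_of_unity_neq0 rho_unit.
have /and5P[_ /eqP b5 /eqP c5 /eqP tb5 _] := abc5.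
have a6 := skew_pow6 Da.
(* [s] fixes [rho ^+ 5], the common fifth power of [b] and [c], and [rho ^+ 6], which is
   [a ^+ 6]. *)
have s_rho : s rho = rho.
  apply: eq_pow56 => //; first by rewrite -rmorphXn -b5 rmorphXn sb c5.
  by rewrite -rmorphXn -a6 rmorphXn sa.
(* From (- t b) ^+ 5 = rho ^+ 5 = b ^+ 5, [t] negates [rho ^+ 5]; it fixes [rho ^+ 6], the sixth
   power of both [a] and a - rho. *)
have t_rho : t rho = - rho.
  apply: eq_pow56; first by rewrite oppr_eq0.
    rewrite -rmorphXn -b5 rmorphXn; apply: oppr_inj.
    by transitivity ((- t b) ^+ 5); [ring | rewrite tb5; ring].
  rewrite -rmorphXn -a6 rmorphXn ta; transitivity ((rho - a) ^+ 6); first by ring.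
  transitivity (rho ^+ 6); last by ring.
  by apply: skew_pow6; rewrite -Da; ring.
have [bc b_rho] : b != c /\ b != rho.
  move: abc_uniq; rewrite 2!cons_uniq !inE !negb_or.
  by case/and3P=> /andP[rb _] /andP[bc _] _; rewrite [b == rho]eq_sym rb bc.
have [m m_gt0 rho_m] : exists2 m, (0 < m)%N & rho ^+ m = 1 by apply/root_of_unityP.
have {m m_gt0 rho_m}[m prim_rho _] := prim_order_exists m_gt0 rho_m.
have m_gt0 := prim_order_gt0 prim_rho.
(* [w] is here a primitive sixth root of unity, minus a primitive cube root. *)
pose z := b / rho; pose w := a / rho.
have Dz : b = rho * z by rewrite mulrC divfK.
have Dw : a = rho * w by rewrite mulrC divfK.
have prim_z : 5.-primitive_root z.
  apply: prime_primitive_root => //; first by rewrite exprMn b5 -exprMn divff ?expr1n.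
  by rewrite -(inj_eq (mulfI rho0)) -Dz mulr1.
have sz : s z = c / rho by rewrite fmorph_div sb s_rho.
have Dc : c = rho * z ^+ 4.
  have [r Dr] : {r : 'I_5 | c / rho = z ^+ r}.
    by apply: (prim_rootP prim_z); rewrite exprMn c5 -exprMn divff ?expr1n.
  have Dcr : c = rho * z ^+ r by rewrite -Dr mulrC divfK.
  (* [s] is an involution on [z], so r^2 = 1 modulo 5, and r = 1 would give b = c. *)
  have : s (s z) = z by rewrite sz fmorph_div sc s_rho.
  rewrite sz Dr rmorphXn sz Dr -exprM -[X in _ = X -> _]expr1 => /eqP.
  rewrite (eq_prim_root_expr prim_z).
  case: r Dr Dcr => [[|[|[|[|[|]]]]]] //= lt_r _ Dcr.
  by case/eqP: bc; rewrite Dcr Dz expr1.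
have Dw2 : w ^+ 2 = w - 1.
  apply: (mulfI (_ : rho ^+ 2 != 0)); first by rewrite expf_neq0.
  transitivity (a * (a - rho) + a * rho); first by rewrite Dw; ring.
  by rewrite Da Dw; ring.
have tw : t w = 1 - w by rewrite fmorph_div t_rho ta /w; field.
have w3 : w ^+ 3 = -1.
  by rewrite exprS Dw2 mulrBr -expr2 Dw2; ring.
have w2 : w ^+ 2 != 1.
  apply/eqP=> w2; have /eqP := w3; rewrite exprS w2 mulr1 => /eqP w1.
  have /eqP : 3 = w ^+ 2 - (w - 1) by rewrite w2 w1; ring.
  by rewrite Dw2 subrr pnatr_eq0.
have prim_w := primitive_root6 w3 w2.
have m5 : ~~ (5 %| m)%N.
  apply/negP=> m5; have prim_g := dvdn_prim_root prim_rho m5.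
  have [j Dj] := prim_rootP prim_g (prim_expr_order prim_z).
  case/eqP: bc; apply: (mulIf (_ : rho^-1 != 0)); first by rewrite invr_eq0.
  by rewrite -sz -/z Dj !rmorphXn s_rho.
have prim_w2 : 3.-primitive_root (w ^+ 2).
  by apply: prime_primitive_root => //; rewrite exprAC w3 sqrrN expr1n.
(* Otherwise [w ^+ 2] is a power of g = rho ^+ (m %/ 3). [t] multiplies [g] by a sign, which is 1
   because [g] has order 3; but [t] moves [w ^+ 2]. *)
have m3 : ~~ (3 %| m)%N.
  apply/negP=> m3; have prim_g := dvdn_prim_root prim_rho m3.
  have [j Dj] := prim_rootP prim_g (prim_expr_order prim_w2).
  set g := rho ^+ (m %/ 3) in prim_g Dj.
  have tg : t g = (-1) ^+ (m %/ 3) * g.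
    by rewrite /g rmorphXn t_rho; apply: exprNn.
  have sign1 : (-1) ^+ (m %/ 3) = 1 :> algC.
    have : t g ^+ 3 = 1 by rewrite -rmorphXn (prim_expr_order prim_g) rmorph1.
    by rewrite tg exprMn (prim_expr_order prim_g) mulr1 exprS sqrr_sign mulr1.
  have : t (w ^+ 2) = w ^+ 2 by rewrite Dj rmorphXn tg sign1 mul1r.
  rewrite Dw2 rmorphB rmorph1 tw => /eqP; rewrite -subr_eq0 => /eqP w_half.
  (* [w] would be 1/2, while X^2 - X + 1 has discriminant -3. *)
  have : 3 = 4 * (w ^+ 2 - (w - 1)) - (1 - w - 1 - (w - 1)) ^+ 2 by ring.
  by rewrite w_half Dw2 subrr mulr0 expr0n subr0 => /eqP; rewrite pnatr_eq0.
have m2 : ~~ odd m.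
  apply/negP=> m_odd; have : t rho ^+ m = 1 by rewrite
    -rmorphXn (prim_expr_order prim_rho) rmorph1.
  rewrite t_rho exprNn (prim_expr_order prim_rho) mulr1 -signr_odd m_odd expr1 => /eqP.
  by rewrite -subr_eq0 -opprD oppr_eq0 -(natrD _ 1 1) pnatr_eq0.
(* Applying [t] to [rho ^+ m./2] = -1 gives (-1) ^+ m./2 = 1. *)
have m4 : (4 %| m)%N.
  have Dm : m = (m./2 * 2)%N by rewrite muln2 -[LHS]odd_double_half (negPf m2).
  rewrite Dm -[4%N]/(2 * 2)%N dvdn_pmul2r // dvdn2; apply/negP=> odd_h.
  have : (rho ^+ m./2) ^+ 2 == 1 by rewrite -exprM -Dm (prim_expr_order prim_rho).
  have h_gt0 : (0 < m./2)%N by case: (m./2) odd_h.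
  rewrite sqrf_eq1 -(prim_order_dvd prim_rho) gtnNdvd //; last first.
    by rewrite {2}Dm ltn_Pmulr.
  move=> /eqP rho_h.
  have /eqP : t (rho ^+ m./2) = t (-1) by rewrite rho_h.
  rewrite rmorphXn t_rho exprNn rho_h -signr_odd odd_h expr1 rmorphN1 mulrNN mulr1.
  by rewrite -subr_eq0 opprK -(natrD _ 1 1) pnatr_eq0.
have [k Dk] := prim_rootP zeta6_prim (prim_expr_order prim_w).
have [l Dl] := prim_rootP zeta5_prim (prim_expr_order prim_z).
exists k, l, rho, m; split=> //.
- by rewrite -(natr_Zp (k : 'Z_6)) unitZpE // coprime_sym
    -(prim_root_exp_coprime _ zeta6_prim) -Dk.
- by rewrite -(natr_Zp (l : 'Z_5)) unitZpE // coprime_sym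
    -(prim_root_exp_coprime _ zeta5_prim) -Dl.
- by rewrite m4 m3.
by rewrite Dw Dz Dc -Dk mulnC exprM -Dl; ring.
Qed.

Definition special_form (alpha : algC) :=
  exists (c : 'Z_6) (a : 'Z_5) (eps : algC) (m : nat),
     [/\ c \is a GRing.unit,
         a \is a GRing.unit,
         m.-primitive_root eps,
         [&& 4 %| m, ~~ (3 %| m) & ~~ (5 %| m)]%N
       & alpha = eps * (zeta 6 ^+ c + zeta 5 ^+ a + zeta 5 ^+ (4 * a)%N)].

Lemma length3_shortest (alpha : algC) (e : 'I_3 -> algC) :
    is_length alpha 3 -> (forall i, root_of_unity (e i)) -> \sum_i e i = alpha ->
  shortest e.
Proof. by case=> _ min3 e_unit De; split=> // k; rewrite De card_ord; apply: min3. Qed.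

Lemma degree_le4 (alpha : algC) n : is_length alpha 3 -> is_conductor alpha n ->
  (Q_degree (prim_root n) alpha <= 4)%N /\
  (Q_degree (prim_root n) alpha = 4%N -> special_form alpha).
Proof.
move=> len3 cond; have [[e e_unit De] _] := len3; subst alpha.
have e_short := length3_shortest len3 e_unit erefl.
have [n_gt0 /Q_subP[p Dp] _] := cond; have prim_z := prim_rootE n_gt0.
set alpha := \sum_i e i in Dp cond *; set z := prim_root n in Dp prim_z *.
rewrite (Q_degree_prim_root prim_z Dp); set H := [set k | _].
have [u Du] : exists u : 'I_n -> {rmorphism algC -> algC},
    forall k, k \in H -> forall x, x ^+ n = 1 -> u k x = x ^+ k.
  have [k|u Du] := @fin_all_exists _ _ (fun k (v : {rmorphism algC -> algC}) =>
      k \in H -> forall x, x ^+ n = 1 -> v x = x ^+ k).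
    have [|_] := boolP (k \in H); last by exists idfun.
    by rewrite inE => /andP[/Qn_aut_exists[v Dv] _]; exists v.
  by exists u.
have fix_H k : k \in H -> u k alpha = alpha.
  move=> Hk; rewrite {1}Dp aut_horner_rat Du ?(prim_expr_order prim_z) //.
  by move: Hk; rewrite inE => /andP[_ /eqP].
have inj_H : {in H &, forall k l, (forall i, u k (e i) = u l (e i)) -> k = l}.
  move=> k l Hk Hl ukl; apply/val_inj/eqP.
  have /eqP := conductor_aut_inj e_short cond ukl (prim_expr_order prim_z).
  by rewrite !Du ?(prim_expr_order prim_z) // (eq_prim_root_expr prim_z) !modn_small.
have [/existsP[k0 /andP[Hk0 /forallP no_perm]] | all_perm] :=
  boolP [exists k in H, forall s : 'S_3, exists i, u k (e i) != e (s i)].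
  have [|rho [i [rho_unit skew_i]]] := shortest_skew e_short (fix_H k0 Hk0).
    by move=> s; apply/existsP.
  have [k [l ikl]] := ord3_others i; have skew_t := skew_i k l ikl.
  have [le4 eq4] := skew_family_bound e_short fix_H inj_H ikl rho_unit skew_t.
  split=> // /eq4[h Hh [hi hk]].
  have hl : u h (e l) = e k.
    have := fix_H h Hh; rewrite /alpha (big_ord3 _ ikl) !rmorphD hi hk => /addrI.
    by rewrite [e k + _]addrC => /addrI.
  rewrite /special_form /alpha (big_ord3 _ ikl).
  exact: skew_form rho_unit skew_t hi hk hl.
have le3 : (#|H| <= 3)%N.
  apply: (perm_family_bound e_short inj_H) => k Hk.
  have [//|no_perm] := aut_permP e (u k).
  case/negP: all_perm; apply/existsP; exists k; rewrite Hk; apply/forallP=> s.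
  exact/existsP.
by split; [apply: leqW | move=> H4; rewrite H4 in le3].
Qed.

(** * The converse: four automorphisms fixing the special form *)

Lemma expr_mod_eq (x : algC) m j k : x ^+ m = 1 -> j = k %[mod m] -> x ^+ j = x ^+ k.
Proof. by move=> xm jk; rewrite -(expr_mod _ xm) jk expr_mod. Qed.

(** The four pairs are the powers of (2, 1 + m./2) modulo 15 and m. The pair (4, 1) swaps [z] and
    [z ^+ 4] and fixes [v] and [eps]. The pair (2, 1 + m./2) sends [eps] to - [eps], [v] to 1 - v,
    and [z], [z ^+ 4] to [z ^+ 2], [z ^+ 3]; the sum is restored by 1 + z + z^2 + z^3 + z^4 = 0. *)
Lemma special_twist (u : {rmorphism algC -> algC}) (eps v z : algC) k m r s :
    v ^+ 3 = -1 -> v ^+ 2 = v - 1 -> z ^+ 5 = 1 -> z != 1 -> eps ^+ m = 1 ->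
    eps ^+ (m./2) = -1 -> (4 %| m)%N ->
    u v = v ^+ k -> u z = z ^+ k -> u eps = eps ^+ k ->
    k = r %[mod 15] -> k = s %[mod m] ->
    (r, s) \in [:: (1, 1); (4, 1); (2, 1 + m./2); (8, 1 + m./2)]%N ->
  u (eps * (v + z + z ^+ 4)) = eps * (v + z + z ^+ 4).
Proof.
move=> v3 v2 z5 z1 epsm epsh m4 uv uz ueps kr ks rs.
(* Oddness gives v ^+ k = - (- v) ^+ k, where - [v] has cube 1, so only [k] modulo 3 matters. *)
have k_odd : odd k.
  have s_odd : odd s.
    have h_even : odd m./2 = false.
      by case/dvdnP: m4 => q ->; rewrite -[4%N]/(2 * 2)%N mulnA !muln2 doubleK odd_double.
    by move: rs; rewrite !inE => /or4P[]/eqP[_ ->] //; rewrite oddD h_even.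
  have m2 : (2 %| m)%N := dvdn_trans (isT : 2 %| 4)%N m4.
  by rewrite -[odd k]negbK -dvdn2 /dvdn -(modn_dvdm k m2) ks modn_dvdm //
    -/(dvdn 2 s) dvdn2 s_odd.
have {}uv : u v = - (- v) ^+ r.
  have Nv3 : (- v) ^+ 3 = 1 by transitivity (- v ^+ 3); [ring | rewrite v3 opprK].
  rewrite uv -(expr_mod_eq Nv3 (_ : k = r %[mod 3])).
    by rewrite exprNn -signr_odd k_odd expr1 mulN1r opprK.
  by rewrite -(modn_dvdm k (isT : 3 %| 15)%N) kr modn_dvdm.
have {}uz : u z = z ^+ r.
  rewrite uz; apply: expr_mod_eq z5 _.
  by rewrite -(modn_dvdm k (isT : 5 %| 15)%N) kr modn_dvdm.
have {}ueps : u eps = eps ^+ s by rewrite ueps; apply: expr_mod_eq epsm ks.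
have sum_z : 1 + z + z ^+ 2 + z ^+ 3 + z ^+ 4 = 0.
  have := sum_unity_powers z5; rewrite (negPf z1) mul0r => <-.
  by rewrite !big_ord_recl big_ord0 /=; ring.
rewrite rmorphM !rmorphD rmorphXn uv uz ueps.
move: rs; rewrite !inE => /or4P[]/eqP[-> ->] {uv uz ueps}; rewrite ?exprD ?epsh.
- by ring.
- have -> : (z ^+ 4) ^+ 4 = z by transitivity ((z ^+ 5) ^+ 3 * z);
    [ring | rewrite z5; ring].
  have -> : - (- v) ^+ 4 = v by transitivity (- v ^+ 3 * v); [ring | rewrite v3; ring].
  by ring.
- have -> : (z ^+ 2) ^+ 4 = z ^+ 3 by transitivity (z ^+ 5 * z ^+ 3);
    [ring | rewrite z5; ring].
  transitivity (eps * (v ^+ 2 - (1 + z + z ^+ 2 + z ^+ 3 + z ^+ 4) + 1 + z + z ^+ 4));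
    first by ring.
  by rewrite sum_z v2; ring.
have -> : z ^+ 8 = z ^+ 3 by transitivity (z ^+ 5 * z ^+ 3); [ring | rewrite z5; ring].
have -> : (z ^+ 3) ^+ 4 = z ^+ 2 by transitivity ((z ^+ 5) ^+ 2 * z ^+ 2);
  [ring | rewrite z5; ring].
have -> : (- v) ^+ 8 = v ^+ 2 by transitivity ((v ^+ 3) ^+ 2 * v ^+ 2);
  [ring | rewrite v3; ring].
transitivity (eps * (v ^+ 2 - (1 + z + z ^+ 2 + z ^+ 3 + z ^+ 4) + 1 + z + z ^+ 4));
  first by ring.
by rewrite sum_z v2; ring.
Qed.

Lemma unit_Zp_prim p (z : algC) (k : 'Z_p) : (1 < p)%N ->
  p.-primitive_root z -> k \is a GRing.unit -> p.-primitive_root (z ^+ k).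
Proof.
by move=> p_gt1 prim_z; rewrite
  -{1}(natr_Zp k) unitZpE // prim_root_exp_coprime // coprime_sym.
Qed.

(** The summands are (lcm 2 n)-th roots of unity; the ratio [z ^+ 3] of two of them yields [z], then
    [eps] and [v], so 15 * m divides lcm 2 n. As 4 divides [m], [n] is even and equals lcm 2 n.
    Conversely the summands are (15 * m)-th roots of unity. *)
Lemma special_conductor alpha n (eps v z : algC) m :
    is_length alpha 3 -> is_conductor alpha n ->
    m.-primitive_root eps -> 6.-primitive_root v -> 5.-primitive_root z ->
    (4 %| m)%N -> coprime 15 m -> alpha = eps * (v + z + z ^+ 4) ->
  n = (15 * m)%N.
Proof.
move=> len3 cond prim_eps prim_v prim_z m4 co_m Dalpha.
have m_gt0 := prim_order_gt0 prim_eps.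
pose e (i : 'I_3) := match val i with 0 => eps * v | 1 => eps * z | _ => eps * z ^+ 4 end.
have eps_unit := root_of_unity_prim prim_eps.
have z_unit := root_of_unity_prim prim_z.
have e_unit i : root_of_unity (e i).
  rewrite /e; case: (val i) => [|[|_]]; apply: root_of_unityM => //;
    last exact: root_of_unityX.
  exact: root_of_unity_prim prim_v.
have De : \sum_i e i = alpha.
  by rewrite !big_ord_recl big_ord0 Dalpha /e /=; ring.
have e_short := length3_shortest len3 e_unit De.
have [n_gt0 _ n_min] := cond.
have eL : forall i, e i ^+ lcmn 2 n = 1.
  apply: (shortest_in_field n_gt0 e_short) => u fix_u; rewrite De.
  exact: conductor_fixed cond fix_u.
set L := lcmn 2 n in eL.
have [eps0 z0] := conj (root_of_unity_neq0 eps_unit) (root_of_unity_neq0 z_unit).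
have eV : (eps * v) ^+ L = 1 := eL ord0.
have eZ : (eps * z) ^+ L = 1 := eL (@Ordinal 3 1 isT).
have eZ4 : (eps * z ^+ 4) ^+ L = 1 := eL (@Ordinal 3 2 isT).
have L5 : (5 %| L)%N.
  rewrite -(Gauss_dvdr L (isT : coprime 5 3)) (prim_order_dvd prim_z).
  apply/eqP; apply: (mulfI (_ : (eps * z) ^+ L != 0)); first by rewrite eZ oner_eq0.
  by rewrite mulr1 exprM -exprMn -mulrA -exprS eZ4 eZ.
have zL : z ^+ L = 1 by apply/eqP; rewrite -(prim_order_dvd prim_z).
have epsL : eps ^+ L = 1 by rewrite exprMn zL mulr1 in eZ.
have vL : v ^+ L = 1 by rewrite exprMn epsL mul1r in eV.
have mL : (m %| L)%N by rewrite (prim_order_dvd prim_eps) epsL.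
have L6 : (6 %| L)%N by rewrite (prim_order_dvd prim_v) vL.
have L3 : (3 %| L)%N by apply: dvdn_trans L6.
have DL : L = n.
  apply/eqP; rewrite eqn_dvd dvdn_lcmr andbT dvdn_lcm dvdnn andbT.
  apply/negPn/negP => n_odd; have := dvdn_trans m4 mL; rewrite /L.
  have -> : lcmn 2 n = (2 * n)%N.
    have /eqnP co2 : coprime 2 n by rewrite prime_coprime.
    by rewrite -(muln_lcm_gcd 2 n) co2 muln1.
  by rewrite -[4%N]/(2 * 2)%N dvdn_pmul2l // (negPf n_odd).
apply/eqP; rewrite eqn_leq andbC; apply/andP; split.
  apply: dvdn_leq => //; rewrite Gauss_dvd // -DL mL andbT.
  by rewrite (@Gauss_dvd 3 5) ?L3.
apply: n_min; first by rewrite muln_gt0.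
rewrite -De; apply: Q_sub_summands => [|i]; first by rewrite muln_gt0.
have z15 : z ^+ (15 * m) = 1 by apply/eqP; rewrite -(prim_order_dvd prim_z) dvdn_mulr.
have eps15 : eps ^+ (15 * m) = 1 by apply/eqP;
  rewrite -(prim_order_dvd prim_eps) dvdn_mull.
have v15 : v ^+ (15 * m) = 1.
  apply/eqP; rewrite -(prim_order_dvd prim_v) (@Gauss_dvd 2 3) // dvdn_mull ?dvdn_mulr //.
  exact: dvdn_trans m4.
by rewrite /e; case: (val i) => [|[|_]];
  rewrite exprMn ?eps15 ?v15 ?z15 ?mulr1 // exprAC z15 expr1n mulr1.
Qed.

(** Since n = 15 * m with coprime factors, the Chinese remainder theorem turns the four pairs of
    residues into exponents, distinct already modulo 15. *)
Lemma special_degree alpha n :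
    is_length alpha 3 -> is_conductor alpha n -> special_form alpha ->
  (4 <= Q_degree (prim_root n) alpha)%N.
Proof.
move=> len3 cond [c [a [eps [m [c_unit a_unit prim_eps /and3P[m4 m3 m5] Dalpha]]]]].
set v := zeta 6 ^+ c in Dalpha; set z := zeta 5 ^+ a in Dalpha.
have prim_v : 6.-primitive_root v by apply: unit_Zp_prim zeta6_prim c_unit.
have prim_z : 5.-primitive_root z by apply: unit_Zp_prim zeta5_prim a_unit.
rewrite [(4 * a)%N]mulnC exprM -/z in Dalpha.
have co_m : coprime 15 m by rewrite -[15%N]/(3 * 5)%N coprimeMl !prime_coprime // m3.
have Dn := special_conductor len3 cond prim_eps prim_v prim_z m4 co_m Dalpha.
have [n_gt0 /Q_subP[p Dp] _] := cond; have prim_n := prim_rootE n_gt0.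
have m_gt0 := prim_order_gt0 prim_eps.
have m2 : (2 %| m)%N := dvdn_trans (isT : 2 %| 4)%N m4.
have v3 : v ^+ 3 = -1.
  have /eqP : (v ^+ 3) ^+ 2 = 1 by rewrite -exprM (prim_expr_order prim_v).
  by rewrite sqrf_eq1 -(prim_order_dvd prim_v) => /eqP.
have v2 : v ^+ 2 = v - 1.
  apply/eqP; rewrite -subr_eq0; apply/eqP/(mulIf (_ : v + 1 != 0)).
    rewrite addr_eq0; apply/eqP=> v1; have : v ^+ 2 == 1 by rewrite v1 sqrrN expr1n.
    by rewrite -(prim_order_dvd prim_v).
  by transitivity (v ^+ 3 + 1); [ring | rewrite v3; ring].
have z1 : z != 1 by rewrite -(prim_order_dvd prim_z 1).
have epsm := prim_expr_order prim_eps.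
have Dm : (m./2 * 2)%N = m by rewrite -divn2 divnK.
have epsh : eps ^+ m./2 = -1.
  have /eqP : (eps ^+ m./2) ^+ 2 = 1 by rewrite -exprM Dm.
  rewrite sqrf_eq1 -(prim_order_dvd prim_eps) gtnNdvd; first by move/eqP.
    by rewrite half_gt0 (dvdn_leq _ m2).
  by rewrite -{2}Dm ltn_Pmulr // half_gt0 (dvdn_leq _ m2).
have h_even : odd m./2 = false.
  by apply/negbTE; rewrite -dvdn2 -(@dvdn_pmul2r 2) // Dm.
set rs := [:: (1, 1); (4, 1); (2, 1 + m./2); (8, 1 + m./2)]%N.
pose K q := chinese 15 m q.1 q.2.
have K15 q : K q = q.1 %[mod 15] by apply: chinese_modl.
have Km q : K q = q.2 %[mod m] by apply: chinese_modr.
have co_K q : q \in rs -> coprime (K q) n.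
  move=> q_rs; rewrite Dn coprimeMr -coprime_modl K15 coprime_modl
    -[X in _ && X]coprime_modl Km coprime_modl.
  have co_h : coprime (1 + m./2) m.
    have co_h2 : coprime (1 + m./2) m./2 by rewrite coprime_sym coprimenS.
    by rewrite -{2}Dm coprimeMr co_h2 coprimen2 oddD h_even.
  by move: q_rs; rewrite !inE => /or4P[]/eqP->; rewrite //= ?coprime1n.
have fix_K q : q \in rs -> (pQtoC p).[prim_root n ^+ K q] = alpha.
  move=> q_rs; have [u Du] := Qn_aut_exists (co_K q q_rs).
  have Dun x d : x ^+ d = 1 -> (d %| n)%N -> u x = x ^+ K q.
    by move=> xd /dvdnP[j Dj]; rewrite Du // Dj mulnC exprM xd expr1n.
  rewrite -(Du _ (prim_expr_order prim_n)) -aut_horner_rat -Dp Dalpha.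
  apply: (special_twist v3 v2 (prim_expr_order prim_z) z1 epsm epsh m4 _ _ _ (K15 q) (Km q)).
  - apply: Dun (prim_expr_order prim_v) _.
    by rewrite Dn (@Gauss_dvd 2 3) // dvdn_mull // dvdn_mulr.
  - by apply: Dun (prim_expr_order prim_z) _; rewrite Dn dvdn_mulr.
  - by apply: Dun epsm _; rewrite Dn dvdn_mull.
  - by rewrite -surjective_pairing.
rewrite (Q_degree_prim_root prim_n Dp); set H := [set k | _].
pose s := [seq Ordinal (ltn_pmod (K q) n_gt0) | q <- rs].
rewrite -[4%N]/(size s) cardE; apply: uniq_leq_size.
  rewrite map_inj_in_uniq // => q q' q_rs q'_rs [] /(congr1 (modn^~ 15)).
  rewrite !modn_dvdm ?Dn ?dvdn_mulr // !K15.
  by move: q_rs q'_rs; rewrite !inE => /or4P[]/eqP-> /or4P[]/eqP->.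
move=> _ /mapP[q q_rs ->]; rewrite mem_enum inE /= coprime_modl co_K //=.
by rewrite prim_expr_mod // fix_K.
Qed.

Theorem theorem4 (alpha : algC) (n : nat)
  (alpha_cyc : cyclotomic_integer alpha)
  (alpha_len : is_length alpha 3)
  (alpha_cond : is_conductor alpha n) :
  (Q_degree (prim_root n) alpha <= 4)%N /\
  (Q_degree (prim_root n) alpha = 4%N <->
   exists (c : 'Z_6) (a : 'Z_5) (eps : algC) (m : nat),
     [/\ c \is a GRing.unit,
         a \is a GRing.unit,
         m.-primitive_root eps,
         [&& 4 %| m, ~~ (3 %| m) & ~~ (5 %| m)]%N
       & alpha = eps * (zeta 6 ^+ c + zeta 5 ^+ a + zeta 5 ^+ (4 * a)%N)]).
Proof.
have [le4 eq4] := degree_le4 alpha_len alpha_cond.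
split=> //; split=> // form; apply/eqP; rewrite eqn_leq le4.
exact: special_degree alpha_len alpha_cond form.
Qed.
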